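(* There is an algorithm which, given a simple connected undirected graph $G=(V,E)$ with at least two nodes, computes a port numbering of $G$ together with a witness cycle for it, and runs in $O(|E|)$ time.
   Context: A port numbering of $G$ assigns to each node $v$ of degree $d_v$ a bijection from the edges incident to $v$ onto $\{1,\dots,d_v\}$. For each edge $\{u,v\}$ consider the two arcs $(u,v)$ and $(v,u)$. Given a port numbering, the right-hand successor of arc $(u,v)$ is the arc $(v,w)$ where the port number of $\{v,w\}$ at $v$ equals $(i\bmod d_v)+1$, with $i$ the port number of $\{u,v\}$ at $v$. This successor map is a permutation of the arcs; its cycles are RH-cycles. A witness cycle is an RH-cycle such that every node of $G$ is an endpoint of some of its arcs. *)

(* Defs.v *)
From mathcomp Require Import all_boot.
Set Implicit Arguments.
Unset Strict Implicit.
Unset Printing Implicit Defensive.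

Section Graphs.
Variables (V : finType) (e : rel V).

Definition simple_graph : Prop := symmetric e /\ irreflexive e.

Definition connected_graph : Prop := forall u v, connect e u v.

Definition edges : {set {set V}} :=
  [set [set a.1; a.2] | a : V * V & e a.1 a.2].

Definition incident (v : V) : {set {set V}} := [set E in edges | v \in E].

Definition degree (v : V) : nat := #|incident v|.

(* [p v E] is the port number of the edge [E] at the node [v]; the values of
   [p v] on sets that are not edges incident to [v] are irrelevant. *)
Definition port_numbering (p : V -> {set V} -> nat) : Prop :=
  forall v,
    {in incident v &, injective (p v)} /\
    (forall i, 1 <= i <= degree v <-> exists2 E, E \in incident v & p v E = i).

Definition arc (a : V * V) : bool := e a.1 a.2.

(* The graph of the successor map on arcs: it is a total bijective relation on
   arcs whenever [p] is a port numbering (see [rh_succP] and [rh_predP]). *)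
Definition rh_succ (p : V -> {set V} -> nat) : rel (V * V) := fun a b =>
  let v := a.2 in
  [&& arc a, arc b, b.1 == v &
      p v [set b.1; b.2] == (p v [set a.1; a.2] %% degree v).+1].

(* A cycle of the successor permutation, listed from any of its arcs. *)
Definition rh_cycle (p : V -> {set V} -> nat) (W : seq (V * V)) : Prop :=
  W <> [::] /\ ucycle (rh_succ p) W.

Definition witness_cycle (p : V -> {set V} -> nat) (W : seq (V * V)) : Prop :=
  rh_cycle p W /\ forall v, exists2 a, a \in W & v = a.1 \/ v = a.2.

Definition adjacency_lists (adj : V -> seq V) : Prop :=
  forall v, uniq (adj v) /\ adj v =i e v.

End Graphs.

Section SuccessorMap.
Variables (V : finType) (e : rel V) (p : V -> {set V} -> nat).
Hypotheses (Ge : simple_graph e) (Pp : port_numbering e p).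

Lemma arc_incident u v : e u v ->
  [set u; v] \in incident e u /\ [set u; v] \in incident e v.
Proof.
by move=> uv; rewrite !inE !eqxx orbT andbT; split; apply/imsetP; exists (u, v);
  rewrite ?inE.
Qed.

Lemma incident_arc v E : E \in incident e v -> exists2 w, e v w & E = [set v; w].
Proof.
rewrite inE => /andP[/imsetP[[x y]]]; rewrite inE /= => xy ->.
rewrite !inE => /orP[]/eqP->; first by exists y.
by exists x; rewrite ?[e y x]Ge.1 // setUC.
Qed.

Lemma set2_inj (v u w : V) : e v u -> [set v; u] = [set v; w] -> u = w.
Proof.
move=> vu /setP/(_ u); rewrite !inE eqxx orbT => /esym/orP[]/eqP // uv.
by rewrite uv Ge.2 in vu.
Qed.

Lemma rh_succP a : arc e a -> exists! b, rh_succ e p a b.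
Proof.
case: a => u v uv; have [_ inv] := arc_incident uv.
have [inj sur] := Pp v.
have d_gt0 : 0 < degree e v by apply/card_gt0P; exists [set u; v].
have /sur[E /incident_arc[w vw ->] pw] :
  1 <= (p v [set u; v] %% degree e v).+1 <= degree e v by rewrite /= ltn_mod.
exists (v, w); split; first by rewrite /rh_succ /= uv /arc /= vw eqxx pw eqxx.
case=> x y /and4P[_ + /eqP/= xv]; rewrite {}xv /arc /= => vy /eqP py.
congr pair; apply: (set2_inj vw); apply: inj; rewrite ?pw ?py //.
  by have [] := arc_incident vw.
by have [] := arc_incident vy.
Qed.

Lemma modn_inj1 d i j : 1 <= i <= d -> 1 <= j <= d -> i %% d = j %% d -> i = j.
Proof.
case: i j => [|i] [|j] //= id jd /eqP.
by rewrite -[i.+1]addn1 -[j.+1]addn1 eqn_modDr !modn_small // => /eqP->.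
Qed.

Lemma rh_predP b : arc e b -> exists! a, rh_succ e p a b.
Proof.
case: b => v w; rewrite /arc /= => vw; have [inv _] := arc_incident vw.
have [inj sur] := Pp v.
set d := degree e v; set k := p v [set v; w].
have d_gt0 : 0 < d by apply/card_gt0P; exists [set v; w].
have portP u : e v u -> 1 <= p v [set v; u] <= d.
  by move=> vu; apply/sur; exists [set v; u] => //; have [] := arc_incident vu.
have /andP[k_gt0 k_le] : 1 <= k <= d := portP _ vw.
have /sur[E /incident_arc[u vu ->] pu] :
    1 <= (if k == 1 then d else k.-1) <= d.
  case: ifPn => [_|kn1]; first by rewrite d_gt0 leqnn.
  by case: (k) k_gt0 k_le kn1 => [|[|j]] //= _ /ltnW.
exists (u, v); split.
  rewrite /rh_succ /arc /= [e u v]Ge.1 vu vw eqxx /= -/d -/k [[set u; v]]setUC pu.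
  case: ifPn => [/eqP->|kn1]; first by rewrite modnn.
  by case: (k) k_gt0 k_le kn1 => [|[|j]] // _ kd _; rewrite modn_small.
case=> y z /and4P[+ _ /eqP/= vz]; rewrite -{}vz /arc /= => yv.
rewrite -/d -/k => /eqP pk.
have vy : e v y by rewrite Ge.1.
congr pair; apply: (set2_inj vu); apply: inj.
- by have [] := arc_incident vu.
- by have [] := arc_incident vy.
apply: (@modn_inj1 d); rewrite ?portP //; apply: succn_inj.
rewrite pu [[set v; y]]setUC -pk.
case: ifPn => [/eqP->|kn1]; first by rewrite modnn.
by case: (k) k_gt0 k_le kn1 => [|[|j]] // _ kd _; rewrite modn_small.
Qed.

End SuccessorMap.

(* Unit-cost random access machine: countably many registers holding natural
   numbers, indirect addressing, addition and truncated subtraction, a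
   read-only input tape (reading past its end yields 0) and a write-only output
   tape. *)
Inductive instr : Type :=
| OpConst of nat & nat
| OpAdd of nat & nat & nat
| OpSub of nat & nat & nat
| OpLoad of nat & nat
| OpStore of nat & nat
| OpJump of nat
| OpJzero of nat & nat
| OpRead of nat
| OpWrite of nat.

Definition program := seq instr.

Record config := Config {
  pc : nat;
  reg : nat -> nat;
  input : seq nat;
  output : seq nat }.

Definition exec (ins : instr) (s : config) : config :=
  let: Config l r x y := s in
  match ins with
  | OpConst i a => Config l.+1 [eta r with i |-> a] x y
  | OpAdd i j k => Config l.+1 [eta r with i |-> r j + r k] x y
  | OpSub i j k => Config l.+1 [eta r with i |-> r j - r k] x y
  | OpLoad i j => Config l.+1 [eta r with i |-> r (r j)] x y
  | OpStore i j => Config l.+1 [eta r with r i |-> r j] x y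
  | OpJump l' => Config l' r x y
  | OpJzero i l' => Config (if r i == 0 then l' else l.+1) r x y
  | OpRead i => Config l.+1 [eta r with i |-> head 0 x] (behead x) y
  | OpWrite i => Config l.+1 r x (rcons y (r i))
  end.

(* A configuration whose program counter is outside the program is halting. *)
Definition step (P : program) (s : config) : config :=
  if onth P (pc s) is Some ins then exec ins s else s.

Definition init (x : seq nat) : config := Config 0 (fun=> 0) x [::].

Definition run (P : program) (x : seq nat) (t : nat) : config :=
  iter t (step P) (init x).

(* [P] halts on input [x] after at most [T] steps with output [y], and no
   register exceeds [B] at any time. Bounding the registers by a polynomial in
   the size of the instance amounts to machine words of logarithmic length; it
   prevents unit-cost arithmetic on huge numbers. *)
Definition ram_computes (P : program) (x y : seq nat) (T B : nat) : Prop :=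
  exists t, [/\ t <= T,
    size P <= pc (run P x t),
    output (run P x t) = y &
    forall s i, s <= t -> reg (run P x s) i <= B].

(* The number of nodes, then, for each node, its degree followed by its
   neighbours. *)
Definition graph_code (n : nat) (adj : 'I_n -> seq 'I_n) : seq nat :=
  n :: flatten [seq size (adj v) :: [seq val u | u <- adj v] | v <- enum 'I_n].

(* For each node, the port numbers of its edges in the order of its adjacency
   list; then the length of the cycle; then the arcs (tail, head) of the cycle
   in order. *)
Definition solution_code (n : nat) (adj : 'I_n -> seq 'I_n)
    (p : 'I_n -> {set 'I_n} -> nat) (W : seq ('I_n * 'I_n)) : seq nat :=
  flatten [seq [seq p v [set v; u] | u <- adj v] | v <- enum 'I_n]
  ++ size W :: flatten [seq [:: val a.1; val a.2] | a <- W].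

(* Main.v *)
(* Write [k = (v, u)] for the dart of the edge [{v, u}] at [v], which stands for
   the arc from [u] to [v]. The ports at [v] order its darts cyclically, by a
   permutation [N], and the successor of an arc is [sigma k = T (N k)], where
   [T] exchanges the two darts of an edge.

   Start from the cyclic orders given by the adjacency lists and let [C] be the
   cycle of [sigma] through the first dart. If [a] is in [C] and [x], [y] are
   darts outside [C] at the same node, met in the order [a], [x], [y], then
   replacing [N a], [N x], [N y] by [N x], [N y], [N a] keeps a single cyclic
   order at the node, and the cycle through [a] becomes [C] with an excursion
   inserted after [a] that passes through [y] (and through [x] too when [x] and
   [y] were on different cycles).

   Walk along [C]. On the first visit of a node, scan its darts once, making the
   replacement whenever two of them lie outside [C]; the excursions are inserted
   ahead of the walk. Each dart is scanned, marked and walked over once, so that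
   the time is linear. In the end every node [v] on [C] has at most one dart
   outside [C]. If a neighbour [w] of [v] were not on [C], then [k = (v, w)] and
   its predecessor under [N] would both be outside [C], hence [N k = k] and [v]
   would have degree one, although it also has a dart in [C]. *)
Require Import Defs.
From mathcomp Require Import all_boot zify.
Set Implicit Arguments.
Unset Strict Implicit.
Unset Printing Implicit Defensive.

(** * A while-language compiled to the machine *)

Definition upd (A : Type) (f : nat -> A) i v := fun j => if j == i then v else f j.
Arguments upd A f i v j /.

Record store := Store {
  lv : nat -> nat;
  ar : nat -> nat -> nat;
  inp : seq nat;
  out : seq nat }.

Inductive prim :=
| Cst of nat & nat
| Add of nat & nat & nat
| Sub of nat & nat & nat
| Get of nat & nat & nat
| Put of nat & nat & nat
| Rd of nat
| Wr of nat.

Definition pexec (s : store) (p : prim) : store :=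
  let: Store l h x y := s in
  match p with
  | Cst i a => Store (upd l i a) h x y
  | Add i j k => Store (upd l i (l j + l k)) h x y
  | Sub i j k => Store (upd l i (l j - l k)) h x y
  | Get i f j => Store (upd l i (h f (l j))) h x y
  | Put f j k => Store l (upd h f (upd (h f) (l j) (l k))) x y
  | Rd i => Store (upd l i (head 0 x)) h (behead x) y
  | Wr i => Store l h x (rcons y (l i))
  end.

(** Side conditions that keep every value at most [b]: differences, array cells and input items are
    already bounded, so only constants and sums are checked. The register layout has room for eight
    arrays. *)
Definition pok (b : nat) (s : store) (p : prim) : Prop :=
  match p with
  | Cst _ a => a <= b
  | Add _ j k => lv s j + lv s k <= b
  | Get _ f _ | Put f _ _ => f < 8
  | _ => True
  end.

Inductive cmd :=
| Blk of seq prim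
| Seq of cmd & cmd
| If of nat & cmd & cmd
| While of nat & cmd.

Fixpoint bwp (b : nat) (ps : seq prim) (Q : store -> Prop) (s : store) : Prop :=
  if ps is p :: ps' then pok b s p /\ bwp b ps' Q (pexec s p) else Q s.

(* Local variable [i] is register [16 i + 8] and the cell [k] of the array
   [f < 8] is register [16 k + f]; registers 9 and 10 are scratch. *)
Definition lreg i := 16 * i + 8.
Definition areg f k := 16 * k + f.

(** Four doublings multiply the index by 16, as the machine has no multiplication; the address ends
    up in register 9. *)
Definition addr_code f j :=
  [:: OpAdd 9 (lreg j) (lreg j); OpAdd 9 9 9; OpAdd 9 9 9; OpAdd 9 9 9;
      OpConst 10 f; OpAdd 9 9 10].

Definition pcomp (p : prim) : program :=
  match p with
  | Cst i a => [:: OpConst (lreg i) a]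
  | Add i j k => [:: OpAdd (lreg i) (lreg j) (lreg k)]
  | Sub i j k => [:: OpSub (lreg i) (lreg j) (lreg k)]
  | Get i f j => addr_code f j ++ [:: OpLoad (lreg i) 9]
  | Put f j k => addr_code f j ++ [:: OpStore 9 (lreg k)]
  | Rd i => [:: OpRead (lreg i)]
  | Wr i => [:: OpWrite (lreg i)]
  end.

Fixpoint csize (c : cmd) : nat :=
  match c with
  | Blk ps => size (flatten (map pcomp ps))
  | Seq c1 c2 => csize c1 + csize c2
  | If _ c1 c2 => (csize c1 + (csize c2).+1).+1
  | While _ c => (csize c).+2
  end.

(** Jumps are absolute, hence the parameter [l], the address where the code is placed; [csize] gives
    the targets in advance. *)
Fixpoint compile (l : nat) (c : cmd) : program :=
  match c with
  | Blk ps => flatten (map pcomp ps)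
  | Seq c1 c2 => compile l c1 ++ compile (l + csize c1) c2
  | If i c1 c2 =>
      OpJzero (lreg i) (l.+1 + (csize c1).+1) :: compile l.+1 c1 ++
      OpJump (l + csize (If i c1 c2)) :: compile (l.+1 + (csize c1).+1) c2
  | While i c =>
      OpJzero (lreg i) (l + csize (While i c)) :: compile l.+1 c ++ [:: OpJump l]
  end.

Lemma size_compile c l : size (compile l c) = csize c.
Proof.
elim: c l => [ps|c1 IH1 c2 IH2|i c1 IH1 c2 IH2|i c IH] l //=.
- by rewrite size_cat IH1 IH2.
- by rewrite size_cat /= IH1 IH2.
- by rewrite size_cat /= IH addn1.
Qed.

Definition code_at (P : program) l cs :=
  exists p1 p2, P = p1 ++ cs ++ p2 /\ size p1 = l.

Lemma code_at_catl P l c1 c2 : code_at P l (c1 ++ c2) -> code_at P l c1.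
Proof. by case=> p1 [p2 [-> <-]]; exists p1, (c2 ++ p2); rewrite !catA. Qed.

Lemma code_at_catr P l c1 c2 :
  code_at P l (c1 ++ c2) -> code_at P (l + size c1) c2.
Proof.
by case=> p1 [p2 [-> <-]]; exists (p1 ++ c1), p2; rewrite size_cat !catA.
Qed.

Lemma code_at_head P l i cs : code_at P l (i :: cs) -> onth P l = Some i.
Proof.
case=> p1 [p2 [-> <-]]; rewrite onthE map_cat nth_cat size_map ltnn subnn.
by [].
Qed.

Lemma code_at_tail P l i cs : code_at P l (i :: cs) -> code_at P l.+1 cs.
Proof. by rewrite -cat1s -addn1 => /code_at_catr. Qed.

(** * Weakest preconditions with credits *)

Section WP.
Variables (P : program) (b : nat) (final : config -> Prop).

(** The register bound leaves room for addresses [16 * x + f] with [x <= b] and [f < 8]. *)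
Definition safe k m := exists t, [/\ t <= k, final (iter t (step P) m) &
  forall s i, s <= t -> reg (iter s (step P) m) i <= 16 * b + 16].

Lemma safe_step k m : (forall i, reg m i <= 16 * b + 16) ->
  safe k (step P m) -> safe k.+1 m.
Proof.
move=> bm [t [tk Ft bt]]; exists t.+1; split; rewrite ?iterSr //.
by case=> [|s] i st //; rewrite iterSr; apply: bt.
Qed.

Lemma safe_leq k k' m : k <= k' -> safe k m -> safe k' m.
Proof. by move=> kk [t [tk *]]; exists t; split=> //; apply: leq_trans kk. Qed.

(** The bounds are part of the simulation because an address computed from a local variable respects
    the register bound only if that variable is at most [b]. Scratch registers are bounded but
    otherwise unconstrained. *)
Record sim (s : store) (m : config) : Prop := Sim {
  sim_l : forall i, reg m (lreg i) = lv s i;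
  sim_a : forall f k, f < 8 -> reg m (areg f k) = ar s f k;
  sim_i : input m = inp s;
  sim_o : output m = out s;
  sim_b : forall z, reg m z <= 16 * b + 16;
  sim_lb : forall i, lv s i <= b;
  sim_ab : forall f k, f < 8 -> ar s f k <= b;
  sim_ib : all (fun z => z <= b) (inp s) }.

Lemma lreg_inj i j : (lreg i == lreg j) = (i == j).
Proof. by apply/eqP/eqP => [|-> //]; rewrite /lreg; lia. Qed.

Lemma areg_lreg f k i : f < 8 -> (areg f k == lreg i) = false.
Proof. by move=> f8; apply/eqP; rewrite /lreg /areg; lia. Qed.

Lemma lreg_areg f k i : f < 8 -> (lreg i == areg f k) = false.
Proof. by move=> f8; rewrite eq_sym areg_lreg. Qed.

Lemma areg_inj f k f' k' : f < 8 -> f' < 8 ->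
  (areg f k == areg f' k') = (f == f') && (k == k').
Proof.
by move=> f8 f8'; apply/eqP/andP => [|[/eqP-> /eqP->] //]; rewrite /areg; lia.
Qed.

Lemma rel_set_local s l r x y i a :
  sim s (Config l r x y) -> a <= b ->
  sim (Store (upd (lv s) i a) (ar s) (inp s) (out s))
      (Config l.+1 [eta r with lreg i |-> a] x y).
Proof.
case=> /= rl ra ri ro rb rlb rab rib ab; split=> //=.
- by move=> j; rewrite lreg_inj; case: eqP.
- by move=> f k f8; rewrite areg_lreg ?ra.
- by move=> z; case: eqP => // _; lia.
- by move=> j; case: eqP.
Qed.

Lemma sim_pc s l l' r x y : sim s (Config l r x y) -> sim s (Config l' r x y).
Proof. by case. Qed.

(** The residues 9 and 10 modulo 16 belong to no variable and no array cell, so the simulation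
    survives the use of the scratch registers. *)
Lemma addr_codeP f j s l r x y k :
  code_at P l (addr_code f j) -> f < 8 -> sim s (Config l r x y) ->
  (forall r', r' 9 = areg f (lv s j) -> sim s (Config (l + 6) r' x y) ->
    safe k (Config (l + 6) r' x y)) ->
  safe (k + 6) (Config l r x y).
Proof.
move=> c0 f8 R cont; rewrite !addnS addn0.
have c1 := code_at_tail c0; have c2 := code_at_tail c1.
have c3 := code_at_tail c2; have c4 := code_at_tail c3.
have c5 := code_at_tail c4.
have [/= rl ra ri ro rb rlb rab rib] := R.
have lj i : (lreg i == 9) = false by apply/eqP; rewrite /lreg; lia.
have lj' i : (lreg i == 10) = false by apply/eqP; rewrite /lreg; lia.
have aj g i : g < 8 -> (areg g i == 9) = false.
  by move=> g8; apply/eqP; rewrite /areg; lia.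
have aj' g i : g < 8 -> (areg g i == 10) = false.
  by move=> g8; apply/eqP; rewrite /areg; lia.
have bj := rlb j.
apply: safe_step => //; rewrite /step (code_at_head c0) /=.
apply: safe_step => [z /=|]; first by case: eqP; rewrite ?rl; move: (rb z); lia.
rewrite /step (code_at_head c1) /= ?eqxx.
apply: safe_step => [z /=|].
  by do !case: eqP; rewrite ?rl; move: (rb z); lia.
rewrite /step (code_at_head c2) /= ?eqxx.
apply: safe_step => [z /=|].
  by do !case: eqP; rewrite ?rl; move: (rb z); lia.
rewrite /step (code_at_head c3) /= ?eqxx.
apply: safe_step => [z /=|].
  by do !case: eqP; rewrite ?rl; move: (rb z); lia.
rewrite /step (code_at_head c4) /=.
apply: safe_step => [z /=|].
  by do !case: eqP; rewrite ?rl; move: (rb z); lia.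
rewrite /step (code_at_head c5) /=.
have -> : l.+1.+1.+1.+1.+1.+1 = l + 6 by lia.
apply: cont => /=; first by rewrite rl /areg; lia.
split=> //=.
- by move=> i; rewrite !lj !lj' rl.
- by move=> g i g8; rewrite !aj ?aj' ?ra.
- by move=> z; do !case: eqP; rewrite ?rl; move: (rb z); lia.
Qed.

(** A primitive compiles to at most seven instructions, within the eight steps of one credit. *)
Lemma pcompP p s m k l :
  code_at P l (pcomp p) -> pc m = l -> sim s m -> pok b s p ->
  (forall m', sim (pexec s p) m' -> pc m' = l + size (pcomp p) -> safe k m') ->
  safe (k + 8) m.
Proof.
case: m => l0 r x y /= + l0E; rewrite {l0}l0E => c R.
have [/= rl ra ri ro rb rlb rab rib] := R.
case: s R rl ra ri ro rlb rab rib => sl sh sx sy R /= rl ra ri ro rlb rab rib.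
subst sx sy.
case: p c => [i a|i j i'|i j i'|i f j|f j i'|i|i] c ok cont;
  try (rewrite /= in c ok cont *; apply: (@safe_leq k.+1); first lia;
       apply: safe_step => //; rewrite /step (code_at_head c) /=;
       rewrite addn1 in cont; apply: cont => //).
- exact: (rel_set_local i R ok).
- by rewrite !rl; apply: (rel_set_local i R ok).
- rewrite !rl; apply: (rel_set_local i R) => /=.
  by apply: leq_trans (rlb j); apply: leq_subr.
- apply: (@safe_leq (k.+1 + 6)); first lia.
  apply: (addr_codeP (code_at_catl c) ok R) => r' r9 R'.
  have c7 := code_at_catr c.
  apply: safe_step => [|]; first exact: (sim_b R').
  rewrite /step (code_at_head c7) /=; apply: cont => /=; last by lia.
  have /= <- := sim_a R' (sl j) ok; rewrite -r9.
  apply: (rel_set_local i R'); rewrite r9.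
  by have /= -> := sim_a R' (sl j) ok; apply: rab.
- apply: (@safe_leq (k.+1 + 6)); first lia.
  apply: (addr_codeP (code_at_catl c) ok R) => r' r9 R'.
  have c7 := code_at_catr c.
  apply: safe_step => [|]; first exact: (sim_b R').
  rewrite /step (code_at_head c7) /=; apply: cont => /=; last by lia.
  have /= -> := sim_l R' i'; rewrite r9.
  have [/= rl' ra' _ _ rb' _ _ _] := R'; split=> //=.
  + by move=> i; rewrite lreg_areg.
  + move=> g h g8; rewrite areg_inj //.
    by case: (g =P f) => [e|_] /=; [case: eqP; rewrite -?e|]; rewrite ?ra'.
  + by move=> z; case: eqP => // _; move: (rlb i'); lia.
  + by move=> g h g8; case: (g =P f) => [_|_] /=; [case: eqP|]; rewrite ?rab.
- have hb : head 0 x <= b by case: (x) rib => //= z x' /andP[].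
  have [/= rl' ra' ri' ro' rb' rlb' rab' _] := rel_set_local i R hb.
  by split=> //=; case: (x) rib => //= z x' /andP[].
- by rewrite rl; case: R => *; split.
Qed.

(* [k] counts credits, each worth eight machine steps; [j] is slack. *)
Definition wp (c : cmd) (Q : nat -> store -> Prop) (k : nat) (s : store) :=
  forall l m j, code_at P l (compile l c) -> pc m = l -> sim s m ->
    (forall k' s' m', k' <= k -> Q k' s' -> pc m' = l + csize c ->
       sim s' m' -> safe (8 * k' + j) m') ->
    safe (8 * k + j) m.

Lemma wp_conseq c (Q Q' : nat -> store -> Prop) k s :
  wp c Q k s -> (forall k' s', k' <= k -> Q k' s' -> Q' k' s') -> wp c Q' k s.
Proof.
move=> wc QQ' l m j cl pcm R cont; apply: (wc l m j) => // k' s' m' kk q.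
by apply: cont => //; apply: QQ'.
Qed.

Lemma wp_blk ps Q k s :
  size ps <= k -> bwp b ps (Q (k - size ps)) s -> wp (Blk ps) Q k s.
Proof.
move=> + + l m j; rewrite /= /wp.
elim: ps k s l m => [|p ps IH] k s l m /= psk.
  rewrite subn0 => q cl pcm R cont; apply: (cont k s) => //.
  by rewrite addn0.
case=> okp bp cl pcm R cont.
have -> : 8 * k + j = 8 * k.-1 + j + 8 by lia.
apply: (pcompP (code_at_catl cl) pcm R okp) => m' R' pcm'.
apply: (IH _ _ (l + size (pcomp p)) _ _ _ _ pcm' R') => //; first by lia.
- by move: bp; congr (bwp _ _ (Q _) _); lia.
- exact: (code_at_catr cl).
move=> k' s'' m'' kk q pcm''; apply: cont => //; first by lia.
by rewrite pcm'' size_cat; lia.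
Qed.

Lemma wp_seq c1 c2 Q k s : wp c1 (wp c2 Q) k s -> wp (Seq c1 c2) Q k s.
Proof.
move=> w1 l m j /= cl pcm R cont.
have cl2 := code_at_catr cl; rewrite size_compile in cl2.
apply: (w1 l m j (code_at_catl cl)) => // k' s' m' kk w2 pcm' R'.
apply: (w2 _ _ j cl2) => // k2 s2 m2 kk2 q pcm2 R2.
by apply: cont R2 => //; [lia|rewrite pcm2; lia].
Qed.

(** One credit pays for both the conditional jump and the jump that leaves the first branch. *)
Lemma wp_if i c1 c2 Q k s : 0 < k ->
  (lv s i != 0 -> wp c1 Q k.-1 s) -> (lv s i = 0 -> wp c2 Q k.-1 s) ->
  wp (If i c1 c2) Q k s.
Proof.
move=> k0 w1 w2 l [_ r x y] j /= cl -> R cont.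
have ct := code_at_tail cl.
have cm := code_at_catr ct; rewrite size_compile in cm.
have -> : 8 * k + j = (8 * k.-1 + (j + 7)).+1 by lia.
apply: safe_step; first by case: R.
have ri : r (lreg i) = lv s i := sim_l R i.
rewrite /step (code_at_head cl) /= ri.
case: eqP => [e0|/eqP ne0].
  apply: (w2 e0 _ _ _ _ erefl (sim_pc _ R)).
    by have := code_at_tail cm; rewrite addnS.
  move=> k' s' m' kk q pcm' R'; apply: (@safe_leq (8 * k' + j)); first lia.
  by apply: cont R' => //; [lia|rewrite pcm' /=; lia].
apply: (w1 ne0 l.+1 (Config l.+1 r x y) _ (code_at_catl ct) erefl (sim_pc _ R)).
move=> k' s' [l' r' x' y'] kk q /= -> R'.
apply: (@safe_leq (8 * k' + j).+1); first lia.
apply: safe_step; first by case: R'.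
rewrite /step (code_at_head cm) /=.
by apply: cont (sim_pc _ R') => //; lia.
Qed.

(** Each turn spends a credit, so an invariant that carries the credits left also proves
    termination: the induction is on the credits. *)
Lemma wp_while (Inv : nat -> store -> Prop) i c Q k s :
  (forall k s, Inv k s -> 0 < k /\
     if lv s i == 0 then Q k.-1 s else wp c Inv k.-1 s) ->
  Inv k s -> wp (While i c) Q k s.
Proof.
move=> H I l m j cl pcm R cont.
have ct := code_at_tail cl.
have cm := code_at_catr ct; rewrite size_compile in cm.
elim/ltn_ind: k s I m pcm R cont => k IH s I [l0 r x y] /= l0E R cont.
rewrite {}l0E in R *.
have ri : r (lreg i) = lv s i := sim_l R i.
have [k0] := H k s I.
have -> : 8 * k + j = (8 * k.-1 + (j + 7)).+1 by lia.
case: eqP => [e0|/eqP ne0] w.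
  apply: safe_step; first by case: R.
  rewrite /step (code_at_head cl) /= ri e0 eqxx.
  apply: (@safe_leq (8 * k.-1 + j)); first lia.
  by apply: cont (sim_pc _ R) => //; lia.
apply: safe_step; first by case: R.
rewrite /step (code_at_head cl) /= ri (negPf ne0).
apply: (w l.+1 (Config l.+1 r x y) _ (code_at_catl ct) erefl (sim_pc _ R)).
move=> k' s' [l' r' x' y'] kk q /= -> R'.
apply: (@safe_leq (8 * k' + j).+1); first lia.
apply: safe_step; first by case: R'.
rewrite /step (code_at_head cm) /=.
apply: (IH k' _ s' q (Config l r' x' y') erefl (sim_pc _ R')); first lia.
move=> k2 s2 m2 kk2 q2.
by apply: cont => //; lia.
Qed.

End WP.

Lemma wp_ram c b k x (G : store -> Prop) :
  all (fun z => z <= b) x ->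
  wp (compile 0 c) b (fun m => size (compile 0 c) <= pc m /\
                            exists2 s, G s & output m = out s)
     c (fun _ => G) k (Store (fun=> 0) (fun _ _ => 0) x [::]) ->
  exists2 s, G s & ram_computes (compile 0 c) x (out s) (8 * k) (16 * b + 16).
Proof.
move=> xb /(_ 0 (init x) 0); rewrite addn0.
case; first by exists [::], [::]; rewrite cats0.
- by [].
- by split.
- move=> k' s' m' kk q pcm R; exists 0; split=> //=.
    by split; [rewrite size_compile pcm|exists s'; rewrite ?(sim_o R)].
  by move=> ? i; rewrite leqn0 => /eqP->; apply: (sim_b R).
move=> t [tk [pct [s Gs ys]] bt]; exists s => //.
by exists t; split=> // ? ? ?; apply: bt.
Qed.

(** * Rotations and cycles *)

Section FunctionalPaths.
Variable X : eqType.
Implicit Types (f g : X -> X) (p q : seq X).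

(** A path is determined by the images of its start and inner points, so [g] may start elsewhere as
    long as its first step lands at the same place. *)
Lemma fpath_graft f g x y p z : fpath f x (rcons p z) -> g y = f x ->
  {in p, g =1 f} -> fpath g y (rcons p z).
Proof.
case: p => [|u p] /=; first by move=> + -> _.
move=> /andP[fxu fp] -> gf; rewrite fxu /=.
elim: p u fp gf {fxu} => [|w p IH] u /= /andP[/eqP <- fp] gf.
  by rewrite gf ?mem_head // eqxx.
by rewrite gf ?mem_head // eqxx IH // => v vp; rewrite gf // inE vp orbT.
Qed.

Lemma fpath_pred f x p w : fpath f x p -> w \in p ->
  exists2 c, c \in belast x p & f c = w.
Proof.
elim: p x => [|u p IH] x //= /andP[/eqP fx fp]; rewrite inE => /orP[/eqP->|].
  by exists x; rewrite ?mem_head.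
by case/(IH _ fp) => c cp <-; exists c; rewrite // inE cp orbT.
Qed.

Lemma last_notin_belast x p : uniq (x :: p) -> last x p \notin belast x p.
Proof. by rewrite lastI rcons_uniq => /andP[]. Qed.

(** The cycle consists of three segments, ending in [x], [y] and [a]. The new map enters the second
    from [a], the first from [y] and the third from [x], which joins them again into one cycle. *)
Lemma fcycle_exchange f g a x y p1 p2 q :
  g a = f x -> g x = f y -> g y = f a ->
  (forall z, z \notin [:: a; x; y] -> g z = f z) ->
  uniq (a :: p1 ++ x :: p2 ++ y :: q) ->
  fcycle f (a :: p1 ++ x :: p2 ++ y :: q) ->
  fcycle g (a :: (p2 ++ y :: rcons p1 x) ++ q).
Proof.
move=> ga gx gy gE U.
have : uniq ([:: a; x; y] ++ (p1 ++ p2 ++ q)).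
  apply: etrans U; apply/perm_uniq/permP => P.
  by rewrite /= !(count_cat, cat_cons) /= !count_cat /=; lia.
rewrite cat_uniq => /and3P[_ /hasPn gP _].
have gEin z : z \in p1 ++ p2 ++ q -> g z = f z by move=> /gP/gE.
have cycE p p' p'' u w : rcons (p ++ u :: p' ++ w :: p'') a =
    rcons p u ++ rcons p' w ++ rcons p'' a.
  by rewrite -!cats1 -!catA /= -!catA.
rewrite /= cycE !cat_path !last_rcons => /and3P[F1 F2 F3].
have -> : rcons ((p2 ++ y :: rcons p1 x) ++ q) a =
    rcons p2 y ++ rcons p1 x ++ rcons q a.
  by rewrite -cycE -!cats1 -!catA /= -!catA.
rewrite !cat_path !last_rcons; apply/and3P; split.
- by apply: fpath_graft F2 ga _ => z zp; rewrite gEin // !mem_cat zp orbT.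
- by apply: fpath_graft F1 gy _ => z zp; rewrite gEin // !mem_cat zp.
- by apply: fpath_graft F3 gx _ => z zp; rewrite gEin // !mem_cat zp !orbT.
Qed.

(* The orbit that leaves the cycle at [a] can only come back at [f a]: every
   other element already has a predecessor. *)
Lemma fcycle_splice f g a p q : fcycle f (a :: q) -> uniq (a :: p ++ q) ->
  {in q, g =1 f} -> {in a :: p ++ q &, injective g} ->
  fpath g a p -> p != [::] -> g (last a p) \in a :: p ++ q ->
  fcycle g (a :: p ++ q) /\ g (last a p) = f a.
Proof.
move=> Ff U gq gI Fp p0 gl.
have lp : last a p \in p by case: (p) p0 => //= u p' _; apply: mem_last.
have lq : last a p \notin q.
  move: U; rewrite /= cat_uniq => /and4P[_ _ /hasPn H _].
  by apply/negP => /H; rewrite lp.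
have sub c : c \in belast a p -> c \in a :: p ++ q.
  by move/mem_belast; rewrite !inE mem_cat => /orP[->//|->]; rewrite orbT.
have lin : last a p \in a :: p ++ q by rewrite inE mem_cat lp orbT.
have Up : uniq (a :: p).
  by move: U; rewrite -cat_cons cat_uniq => /andP[].
have glE : g (last a p) = f a.
  have : g (last a p) \notin p.
    apply/negP => /(fpath_pred Fp)[c cb gc].
    have := last_notin_belast Up.
    by rewrite -(gI _ _ (sub _ cb) lin gc) cb.
  move: gl; rewrite inE mem_cat orbCA => /orP[->//|] + _.
  rewrite -in_cons -mem_rcons; move: Ff => /=.
  case E: (rcons q a) => [|h r] //=.
  case/andP=> /eqP fa Fr; rewrite inE fa => /orP[/eqP //|].
  case/(fpath_pred Fr) => c cb fc.
  have cq : c \in q.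
    have : rcons q a = rcons (belast h r) (last h r) by rewrite -lastI.
    by case/rcons_inj => -> _.
  have cin : c \in a :: p ++ q by rewrite inE mem_cat cq !orbT.
  by rewrite -gq // in fc; move: lq; rewrite -(gI _ _ cin lin fc) cq.
split=> //=; rewrite rcons_cat cat_path Fp /=.
exact: fpath_graft Ff glE gq.
Qed.

(** By injectivity the path can return only to its first point [f a], since every later point
    already has a predecessor on it; hence its last point is [a]. *)
Lemma fcycle_close f a p : uniq p -> {in a :: p &, injective f} ->
  fpath f a p -> f (last a p) \in p ->
  exists2 q, fcycle f (a :: q) & p = rcons q a.
Proof.
case: p => [|z p] //= U fI /andP[/eqP fa Fp] fl.
have lin : last z p \in z :: p := mem_last _ _.
have la : last z p = a.
  move: fl; rewrite inE => /orP[/eqP e|].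
    by apply: fI; rewrite ?mem_head ?inE ?fa //; rewrite inE in lin; rewrite lin orbT.
  case/(fpath_pred Fp) => c cb fc; have := last_notin_belast U.
  rewrite -(fI _ _ _ _ fc) ?cb // inE ?lin ?orbT //.
  by rewrite (mem_belast cb) orbT.
exists (belast z p); last by rewrite -la -lastI.
by rewrite /= -{2}la -lastI /= fa eqxx.
Qed.

Lemma fcycle_pred f p w : fcycle f p -> w \in p ->
  exists2 c, c \in p & f c = w.
Proof.
case: p => // a p Fp wp; have wp' : w \in rcons p a by rewrite mem_rcons.
have [c cb fc] := fpath_pred Fp wp'; exists c => //.
by move: cb; rewrite belast_rcons.
Qed.

Lemma fcycle_fix f p k : fcycle f p -> uniq p -> k \in p -> f k = k ->
  p =i [:: k].
Proof.
move=> Fp Up /rot_to[i q pE] fk w.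
rewrite -(mem_rot i) pE; case: q pE => [|u q] pE //.
have : fcycle f (rot i p) by rewrite rot_cycle.
rewrite pE /= fk => /andP[/eqP ku _].
by move: Up; rewrite -(rot_uniq i) pE ku /= mem_head.
Qed.

End FunctionalPaths.

Lemma perm_splice (X : eqType) (a : X) p q r :
  perm_eq (q ++ a :: p ++ r) (p ++ q ++ a :: r).
Proof. by apply/permP => P; rewrite !(count_cat, cat_cons) /= !count_cat; lia. Qed.

(** * Cyclic orders at the nodes and the successor map on darts *)

Section Rings.
Variables (D : nat) (ow hd T : nat -> nat).
Implicit Types (N : nat -> nat) (C R : seq nat).

Definition ring N v R :=
  [/\ uniq R, fcycle N R & forall k, (k \in R) = (k < D) && (ow k == v)].

Definition rings N := forall k, k < D -> exists R, ring N (ow k) R.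

Definition sigma N k := T (N k).

Definition cyc N C :=
  [/\ uniq C, fcycle (sigma N) C & {in C, forall k, k < D}].

(** The condition of a node after its visit. The list [R] also records at which dart the port
    numbers start. *)
Definition done N C (pt : nat -> nat) v := exists R,
  [/\ ring N v R, forall i, i < size R -> pt (nth 0 R i) = i.+1 &
      exists x, forall k, k \in R -> k \notin C -> k = x].

Definition exchange N a x y := upd (upd (upd N a (N x)) x (N y)) y (N a).

Lemma exchange1 N a x y : a != x -> a != y -> exchange N a x y a = N x.
Proof. by rewrite /exchange /= eqxx => /negPf-> /negPf->. Qed.

Lemma exchange2 N a x y : x != y -> exchange N a x y x = N y.
Proof. by rewrite /exchange /= eqxx => /negPf->. Qed.

Lemma exchange3 N a x y : exchange N a x y y = N a.
Proof. by rewrite /exchange /= eqxx. Qed.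

Lemma exchangeE N a x y z : z \notin [:: a; x; y] -> exchange N a x y z = N z.
Proof.
by rewrite !inE !negb_or => /and3P[/negPf za /negPf zx /negPf zy];
  rewrite /exchange /= za zx zy.
Qed.

Lemma ring_ext N N' v R : ring N v R -> {in R, N' =1 N} -> ring N' v R.
Proof.
case=> U F M NN; split=> //; rewrite -(@eq_in_cycle _ (mem R) (frel N)) //.
  by move=> k k' kR _ /=; rewrite NN.
Qed.

(** Only the scanned part of the ring is permuted: the darts [B] still to be scanned keep their
    order, so that a scan in progress can go on. *)
Lemma ring_exchange N v a A x s B :
  ring N v (a :: A ++ s :: B) -> x \in A ->
  exists A', [/\ ring (exchange N a x s) v (a :: A' ++ B) &
    A' =i s :: A].
Proof.
case=> U F M xA; have [A1 [A2 AE]] : exists A1 A2, A = A1 ++ x :: A2.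
  by case/splitPr: xA => A1 A2; exists A1, A2.
subst A; rewrite -catA cat_cons in U F M.
have [ax as_ xs] : [/\ a != x, a != s & x != s].
  have : uniq ([:: a; x; s] ++ (A1 ++ A2 ++ B)).
    apply: etrans U; apply/perm_uniq/permP => P.
    by rewrite /= !(count_cat, cat_cons) /= !count_cat /=; lia.
  by rewrite cat_uniq /= !inE negb_or => /andP[/and3P[/andP[]]].
exists (A2 ++ s :: rcons A1 x); split=> [|w]; last first.
  rewrite !(mem_cat, inE, mem_rcons).
  by do !case: (_ == _); do !case: (_ \in _).
split.
- apply: etrans U; apply/perm_uniq/permP => P.
  by rewrite /= -cats1 !(count_cat, cat_cons) /= !count_cat /=; lia.
- apply: fcycle_exchange U F; rewrite ?exchange1 ?exchange2 ?exchange3 //.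
  exact: exchangeE.
move=> k; rewrite -M !(mem_cat, inE, mem_rcons).
by do !case: (_ == _); do !case: (_ \in _).
Qed.

Lemma rings_update N N' v R : rings N -> ring N' v R ->
  (forall k, k < D -> ow k != v -> N' k = N k) -> rings N'.
Proof.
move=> rN rR NN k kD; have [->|ne] := eqVneq (ow k) v; first by exists R.
have [R' r'] := rN k kD; exists R'; apply: (ring_ext r') => j.
by case: r' => _ _ -> /andP[jD /eqP jk]; rewrite NN ?jk.
Qed.

Lemma rings_step N k : rings N -> k < D -> N k < D /\ ow (N k) = ow k.
Proof.
move=> rN kD; have [R [_ F M]] := rN k kD.
have : N k \in R by apply: (mem_fcycle F); rewrite M kD eqxx.
by rewrite M => /andP[-> /eqP->].
Qed.

Lemma rings_inj N : rings N -> {in gtn D &, injective N}.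
Proof.
move=> rN j k jD kD jk; have [R [_ F M]] := rN k kD.
apply: (inj_cycle F) => //; rewrite M; apply/andP; split=> //.
by rewrite -(rings_step rN kD).2 -(rings_step rN jD).2 jk.
Qed.

Hypothesis TP : forall k, k < D -> [/\ T k < D, T (T k) = k & ow (T k) = hd k].

Lemma sigma_lt N k : rings N -> k < D -> sigma N k < D.
Proof. by move=> rN /(rings_step rN)[/TP[]]. Qed.

Lemma sigma_inj N : rings N -> {in gtn D &, injective (sigma N)}.
Proof.
move=> rN j k jD kD jk; apply: (rings_inj rN) => //.
have [Nj _] := rings_step rN jD; have [Nk _] := rings_step rN kD.
by have [_ <- _] := TP Nj; have [_ <- _] := TP Nk; rewrite -/(sigma N j) jk.
Qed.

(** On [C] the new successor map differs from the old one only at [a], so [fcycle_splice] applies to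
    the excursion [Z], whichever cycles [x] and [y] were on. *)
Lemma cyc_exchange N C1 C2 a x y Z (C := C1 ++ a :: C2)
    (N' := exchange N a x y) :
  cyc N C -> rings N -> rings N' -> x < D -> y < D -> x != y ->
  x \notin C -> y \notin C ->
  uniq Z -> {in Z, forall k, k < D /\ k \notin C} -> fpath (sigma N') a Z ->
  sigma N' (last a Z) \in C ++ Z ->
  cyc N' (C1 ++ a :: Z ++ C2) /\ y \in Z.
Proof.
move=> [U F CD] rN rN' xD yD xy xC yC UZ ZC FZ lZ.
have aC : a \in C by rewrite mem_cat mem_head orbT.
have ax : a != x by apply: contraNneq xC => <-.
have ay : a != y by apply: contraNneq yC => <-.
(* The excursion begins at [sigma N x]; if that were on [C], injectivity would put [x] on [C]. *)
have Z0 : Z != [::].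
  case: (Z) lZ => //=; rewrite cats0 /sigma /N' exchange1 // => /(fcycle_pred F).
  case=> c cC /(sigma_inj rN) cx; case/negP: xC; rewrite -cx //.
  exact: CD.
have F' : fcycle (sigma N) (a :: C2 ++ C1) by rewrite -cat_cons cycle_catC.
have memC k : (k \in a :: Z ++ C2 ++ C1) = (k \in C) || (k \in Z).
  by rewrite !(inE, mem_cat); do !case: (_ == _); do !case: (_ \in _).
have UC : uniq (a :: Z ++ C2 ++ C1).
  have : uniq (Z ++ C).
    by rewrite cat_uniq UZ U andbT; apply/hasPn => k kC; apply/negP => /ZC[_ /negP].
  by rewrite -(perm_uniq (perm_splice _ _ _ _)) uniq_catC cat_cons -catA.
have CZD k : k \in a :: Z ++ C2 ++ C1 -> k < D.
  by rewrite memC => /orP[/CD|/ZC[]].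
have N'E : {in C2 ++ C1, sigma N' =1 sigma N}.
  move=> k kC; rewrite /sigma /N' exchangeE //.
  have kC' : k \in C by rewrite mem_cat inE orbA orbC orbA -mem_cat kC.
  rewrite !inE !negb_or; apply/and3P; split.
  - apply: contraTneq kC => ->; move: U; rewrite /C -[uniq _](uniq_catC).
    by rewrite /= => /andP[].
  - by apply: contraNneq xC => <-.
  - by apply: contraNneq yC => <-.
have gI : {in a :: Z ++ C2 ++ C1 &, injective (sigma N')}.
  by move=> j k /CZD jD /CZD kD; apply: (sigma_inj rN').
rewrite mem_cat -memC in lZ.
have [FC la] := fcycle_splice F' UC N'E gI FZ Z0 lZ; split.
  split.
  - by rewrite uniq_catC cat_cons -catA.
  - by rewrite cycle_catC /= -catA.
  - move=> k; rewrite mem_cat inE mem_cat => kC; apply: CZD.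
    by rewrite !(inE, mem_cat) orbC -!orbA in kC *.
have lZ' : last a Z \in Z by case: (Z) Z0 => //= u p _; apply: mem_last.
(* The excursion returns at [sigma N a], which is also the new image of [y], so by injectivity [y]
   is its last dart. *)
suff <- : last a Z = y by [].
apply: (sigma_inj rN') => //; first by have [] := ZC _ lZ'.
by rewrite la /sigma /N' exchange3.
Qed.

Lemma visited_step N C pt j k : cyc N C -> rings N -> j \in C ->
  done N C pt (ow j) -> k < D -> ow k = ow j ->
  exists2 i, i \in C & ow i = hd k.
Proof.
move=> [U F CD] rN jC [R [[UR FR MR] _ [x xP]]] kD kj.
have [Tk TTk oT] := TP kD.
(* If [sigma N c = k] then [N c = T k], so [c] is a dart of [C] at the node [hd k]. *)
have [kC|kC] := boolP (k \in C).
  have [c cC ck] := fcycle_pred F kC; exists c => //.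
  have [Nc <-] := rings_step rN (CD _ cC).
  by rewrite -oT -ck /sigma; have [_ -> _] := TP Nc.
have [TC|TC] := boolP (T k \in C); first by exists (T k).
have kR : k \in R by rewrite MR kD kj eqxx.
have [c cR Nc] := fcycle_pred FR kR.
have cC : c \notin C.
  by apply: contraNN TC => /(mem_fcycle F); rewrite /sigma Nc.
(* Both [c] and [k] are off [C] at a single node, hence equal; the ring is then reduced to [k],
   although it contains [j], which is on [C]. *)
have Nk : N k = k by rewrite -{2}Nc (xP _ cR cC) (xP _ kR kC).
have := fcycle_fix FR UR kR Nk j; rewrite MR eqxx CD // inE => /esym/eqP jk.
by rewrite -jk jC in kC.
Qed.

End Rings.

(** * The program *)

(* Arrays indexed by darts: next dart at the node, twin, mark, port, owner, head.
   [MX] is an [n x n] matrix of dart numbers with row offsets in [RW]; it needs no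
   initialization because only the cells of edges are read. *)
Local Notation NX := 0 (only parsing).
Local Notation TW := 1 (only parsing).
Local Notation MK := 2 (only parsing).
Local Notation PT := 3 (only parsing).
Local Notation OW := 4 (only parsing).
Local Notation HD := 5 (only parsing).
Local Notation MX := 6 (only parsing).
Local Notation RW := 7 (only parsing).

Local Notation vn := 0 (only parsing).
Local Notation vp := 1 (only parsing).
Local Notation vrow := 2 (only parsing).
Local Notation vv := 3 (only parsing).
Local Notation vt := 4 (only parsing).
Local Notation vd := 5 (only parsing).
Local Notation vfirst := 6 (only parsing).
Local Notation vu := 7 (only parsing).
Local Notation vq := 8 (only parsing).
Local Notation vlast := 9 (only parsing).
Local Notation vone := 10 (only parsing).
Local Notation vzero := 11 (only parsing).
Local Notation va := 12 (only parsing).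
Local Notation vx := 13 (only parsing).
Local Notation vs := 14 (only parsing).
Local Notation vnext := 15 (only parsing).
Local Notation vz := 16 (only parsing).
Local Notation vm := 17 (only parsing).
Local Notation vcnt := 18 (only parsing).
Local Notation vf := 19 (only parsing).
Local Notation vg := 20 (only parsing).
Local Notation vi := 21 (only parsing).
Local Notation vgo := 22 (only parsing).

(** The variable [vzero] is never written and keeps its initial value 0. *)
Definition mov i j := Sub i j vzero.
Definition neq i j := [:: Sub vt i j; Sub vg j i; Add vt vt vg].

(** The darts of a node get consecutive numbers and are chained in this order; the last is then
    linked back to the first. Adding [n] to [vrow] for each node gives the row offsets of the
    matrix. *)
Definition read_graph : cmd :=
  Seq (Blk [:: Rd vn; Cst vone 1; Sub vt vn vv])
  (While vt
    (Seq (Blk [:: Put RW vv vrow; Rd vd; mov vfirst vp])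
    (Seq (While vd
           (Blk [:: Rd vu; Put OW vp vv; Put HD vp vu; Add vq vrow vu;
                    Put MX vq vp; Sub vd vd vone; Add vq vp vone;
                    Put NX vp vq; mov vlast vp; mov vp vq]))
         (Blk [:: Put NX vlast vfirst; Add vrow vrow vn; Add vv vv vone;
                  Sub vt vn vv])))).

(** The twin of the dart from [v] to [u] is found in row [u], column [v] of the matrix. *)
Definition find_twins : cmd :=
  Seq (Blk [:: Cst vq 0; Sub vt vp vq])
  (While vt
    (Blk [:: Get vu HD vq; Get vv OW vq; Get vd RW vu; Add vd vd vv;
             Get vd MX vd; Put TW vq vd; Add vq vq vone; Sub vt vp vq])).

(** The run stops at the first marked dart: its return to the cycle, or its own first dart when
    nothing was marked before. *)
Definition mark : cmd :=
  Seq (Blk [:: Get vz NX va; Get vz TW vz; Get vm MK vz; Sub vm vone vm])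
  (While vm
    (Blk [:: Put MK vz vone; Add vcnt vcnt vone; Get vz NX vz; Get vz TW vz;
             Get vm MK vz; Sub vm vone vm])).

(* [vx] is the last dart seen outside the cycle; [vx = va], which is marked,
   means that there is none. *)
Definition scan : cmd :=
  Seq (Blk ([:: mov vx va; Get vs NX va] ++ neq vs va))
  (While vt
    (Seq (Blk [:: Get vnext NX vs; Get vm MK vs])
    (Seq (If vm (Blk [::])
           (Seq (Blk [:: Get vm MK vx])
           (If vm (Blk [:: mov vx vs])
             (Seq (Blk [:: Get vf NX va; Get vg NX vx; Put NX va vg;
                           Put NX vx vnext; Put NX vs vf])
                  mark))))
         (Blk (mov vs vnext :: neq vs va))))).

(** The flag [vt] is set by hand because the loop starts at the very dart where it must stop. *)
Definition set_ports : cmd :=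
  Seq (Blk [:: Cst vi 0; mov vs va; Cst vt 1])
  (While vt
    (Blk ([:: Add vi vi vone; Put PT vs vi; Get vs NX vs] ++ neq vs va))).

(* Ports are positive, so that a nonzero [PT] also tells the visited nodes. *)
Definition walk : cmd :=
  Seq (Blk [:: Cst vgo 1])
  (While vgo
    (Seq (Blk [:: Get vt PT va])
    (Seq (If vt (Blk [::]) (Seq scan set_ports))
         (Blk [:: Get va NX va; Get va TW va; mov vgo va])))).

Definition write_ports : cmd :=
  Seq (Blk [:: Cst vq 0; Sub vt vp vq])
  (While vt
    (Blk [:: Get vu PT vq; Wr vu; Add vq vq vone; Sub vt vp vq])).

(** A dart stands for the arc from its head to its owner, hence the order of the two outputs. The
    cycle starts at dart 0, so [va] itself is the loop flag after the first turn. *)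
Definition write_cycle : cmd :=
  Seq (Blk [:: Wr vcnt; Cst vgo 1])
  (While vgo
    (Blk [:: Get vu HD va; Wr vu; Get vu OW va; Wr vu; Get va NX va;
             Get va TW va; mov vgo va])).

Definition witness_cmd : cmd :=
  Seq read_graph (Seq find_twins (Seq mark (Seq walk
    (Seq write_ports write_cycle)))).

(** [oks] discharges the side conditions of a block, and [blk H] pays for it out of the lower bound
    [H] on the credits. *)
Ltac oks := repeat (match goal with |- _ /\ _ => split; [solve [done | lia]|] end).
Ltac blk H := apply: wp_blk; [rewrite /=; clear -H; lia|rewrite /=].

Lemma size_below (D : nat) s : uniq s -> {in s, forall k, k < D} -> size s <= D.
Proof.
move=> U sD; rewrite -(size_iota 0 D); apply: uniq_leq_size => // k /sD.
by rewrite mem_iota.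
Qed.

Lemma neq_eq0 i j : ((i - j) + (j - i) == 0) = (i == j).
Proof. by apply/eqP/eqP; lia. Qed.

(** * Marking, scanning, walking and writing: correctness and cost *)

Section Walk.
Variables (P : program) (b : nat) (final : config -> Prop).
Variables (D : nat) (ow hd T : nat -> nat).
Hypothesis TP : forall k, k < D -> [/\ T k < D, T (T k) = k & ow (T k) = hd k].
Hypothesis Db : D < b.
Notation wp := (wp P b final).

(** [C] lists the marked darts in any order; that it is a cycle of the successor map is stated
    apart, since this fails while an excursion is being marked. *)
Record state (C : seq nat) (s : store) : Prop := State {
  st_one : lv s vone = 1;
  st_zero : lv s vzero = 0;
  st_p : lv s vp = D;
  st_cnt : lv s vcnt = size C;
  st_T : ar s TW = T;
  st_ow : ar s OW = ow;
  st_hd : ar s HD = hd;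
  st_out : out s = [::];
  st_rings : rings D ow (ar s NX);
  st_mark : forall k, k < D -> ar s MK k = (k \in C);
  st_uniq : uniq C;
  st_lt : {in C, forall k, k < D} }.

(** Every unmarked dart holds seven credits, the cost of one turn of the marking loop, and [K] is
    kept for what follows. [Z] is the excursion from [va] up to its return. *)
Definition marked K C (s : store) k' (s' : store) := exists Z,
  [/\ state (C ++ Z) s',
      uniq Z /\ {in Z, forall k, k < D /\ k \notin C},
      fpath (sigma T (ar s NX)) (lv s va) Z /\
      sigma T (ar s NX) (last (lv s va) Z) \in C ++ Z,
      [/\ ar s' NX = ar s NX, ar s' PT = ar s PT &
          forall i, i \notin [:: vz; vm; vcnt] -> lv s' i = lv s i] &
      K + 7 * (D - size (C ++ Z)) <= k'].

Lemma mark_wp K C k s : state C s -> lv s va < D ->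
  K + 7 * (D - size C) + 8 <= k -> wp mark (marked K C s) k s.
Proof.
case: s => l h x y [/= o1 o0 op oc hT how hhd oy rN hM UC CD] aD kK.
apply: wp_seq; blk kK; oks.
have rs j : j < D -> sigma T (h 0) j < D := sigma_lt TP rN.
set N := h 0 in rN rs *; rewrite hT.
apply: (@wp_while _ _ _ (fun k' s' => exists Z,
  [/\ state (C ++ Z) s', uniq Z /\ {in Z, forall k, k < D /\ k \notin C},
   fpath (sigma T N) (l va) Z /\ lv s' vz = sigma T N (last (l va) Z),
   [/\ ar s' NX = N, ar s' PT = h PT, lv s' vm = 1 - ar s' MK (lv s' vz) &
          forall i, i \notin [:: vz; vm; vcnt] -> lv s' i = l i] &
   K + 7 * (D - size (C ++ Z)) + 4 <= k'])).
  move=> k' [l' h' x' y'] [Z [[/= o1' o0' op' oc' hT' how' hhd' oy' rN' hM']]].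
  move=> UCZ CZD [UZ ZC] [FZ zE] [NE PE mE lE] kK'; split; first by lia.
  set z := l' 16 in zE mE *.
  have lD : last (l 12) Z < D.
    case: (Z) ZC => //= u Z' ZC; have := mem_last u Z'.
    by move=> /ZC[].
  have zD : z < D by rewrite zE; apply: rs.
  have mEE : l' 17 = 1 - (z \in C ++ Z) by rewrite mE hM'.
  case: ifP => [/eqP m0|m0].
    exists Z; split=> //=; last by lia.
    split=> //; rewrite -zE; move: m0; rewrite mEE; by case: (z \in _).
  have zCZ : z \notin C ++ Z by apply: contraFN m0 => zC; rewrite mEE zC.
  (* A fresh dart still fits below [D], so the truncated difference really drops by one and releases
     seven credits. *)
  have SZ : size (C ++ rcons Z z) <= D.
    apply: size_below => [|j].
      by rewrite -rcons_cat rcons_uniq zCZ.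
    by rewrite -rcons_cat mem_rcons inE => /orP[/eqP->//|/CZD].
  have SE : size (C ++ rcons Z z) = (size (C ++ Z)).+1.
    by rewrite -rcons_cat size_rcons.
  move: kK' => kK2; have kK' : 7 <= k'.-1 by move: SZ kK2; rewrite SE; clear; lia.
  blk kK'; rewrite o1' -/z oc' addn1 -SE; oks.
  exists (rcons Z z); split=> //=.
  - split=> //=.
    + move=> j jD; rewrite -rcons_cat mem_rcons inE.
      by case: eqP => //= _; apply: hM'.
    + by rewrite -rcons_cat rcons_uniq zCZ.
    + by move=> j; rewrite -rcons_cat mem_rcons inE => /orP[/eqP->//|/CZD].
  - split.
      by rewrite rcons_uniq UZ andbT; apply: contra zCZ; rewrite mem_cat => ->; rewrite orbT.
    move=> j; rewrite mem_rcons inE => /orP[/eqP->|/ZC//]; split=> //.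
    by apply: contra zCZ; rewrite mem_cat => ->.
  - by rewrite last_rcons rcons_path FZ /= zE eqxx NE hT'.
  - split=> // i ii; rewrite -(lE i ii); move: ii.
    by rewrite !inE !negb_or => /and3P[/negPf-> /negPf-> /negPf->].
  - by move: SZ kK2; rewrite SE; clear; lia.
exists [::]; rewrite cats0; split=> //=; last by lia.
split; rewrite ?o1 // => i.
by rewrite !inE !negb_or => /and3P[/negPf-> /negPf-> _].
Qed.

Lemma state_perm C C' s : perm_eq C C' -> state C s -> state C' s.
Proof.
move=> CC [*]; split=> //; first by rewrite -(perm_size CC).
- by move=> k kD; rewrite -(perm_mem CC); auto.
- by rewrite -(perm_uniq CC).
- by move=> k; rewrite -(perm_mem CC); auto.
Qed.

Lemma fcycle_next (f : nat -> nat) a p s q :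
  fcycle f (a :: p ++ s :: q) -> f s = head a q.
Proof.
rewrite /= rcons_cat cat_path /= => /and3P[_ _].
by case: q => [|u q] /=; case/andP=> /eqP.
Qed.

(** [C1] is the part of the cycle already walked, [A] the darts scanned at the node of [a], [B]
    those to come. Excursions are inserted right after [a], so [C1] never changes. At most one
    scanned dart is off the cycle, and then it is [vx]. *)
Record scanning (N0 pt0 : nat -> nat) (C0 C1 : seq nat) a (A B C2 : seq nat)
    (s : store) : Prop := Scanning {
  sc_state : state (C1 ++ a :: C2) s;
  sc_cyc : fcycle (sigma T (ar s NX)) (C1 ++ a :: C2);
  sc_sub : {subset C0 <= C1 ++ a :: C2};
  sc_ring : ring D ow (ar s NX) (ow a) (a :: A ++ B);
  sc_x : forall w, w \in a :: A -> w \notin C1 ++ a :: C2 -> w = lv s vx;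
  sc_xA : lv s vx \in a :: A;
  sc_off : forall k, k < D -> ow k != ow a -> ar s NX k = N0 k;
  sc_pt : ar s PT = pt0;
  sc_a : lv s va = a }.

Lemma scanning_eq N0 pt0 C0 C1 a A B C2 s s' :
  scanning N0 pt0 C0 C1 a A B C2 s -> ar s' = ar s -> out s' = out s ->
  all (fun i => lv s' i == lv s i) [:: vone; vzero; vp; vcnt; va; vx] ->
  scanning N0 pt0 C0 C1 a A B C2 s'.
Proof.
case: s s' => [l h x y] [l' h' x' y'] [[/= s1 s2 s3 s4 s5 s6 s7 s8 s9 s10 s11 s12]].
move=> s13 s14 s15 s16 s17 s18 s19 s20 hh yy /= ll; subst h' y'.
move: ll => /and5P[/eqP l1 /eqP l2 /eqP l3 /eqP l4 /and3P[/eqP l5 /eqP l6 _]].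
by split=> //=; rewrite ?l5 ?l6 //; split=> //=; rewrite ?l1 ?l2 ?l3 ?l4.
Qed.

(** Thirty credits per dart of the ring pay for the scan itself; marking is paid by the unmarked
    darts. *)
Lemma scan_wp K C1 a C2 s k R (C := C1 ++ a :: C2) :
  state C s -> fcycle (sigma T (ar s NX)) C -> lv s va = a ->
  ring D ow (ar s NX) (ow a) R -> K + 7 * (D - size C) + 30 * size R + 10 <= k ->
  wp scan (fun k' s' => exists A C2',
    scanning (ar s NX) (ar s PT) C C1 a A [::] C2' s' /\
    K + 7 * (D - size (C1 ++ a :: C2')) <= k') k s.
Proof.
move=> S0 FC aE rR kK.
have aC : a \in C by rewrite mem_cat mem_head orbT.
have aD : a < D := st_lt S0 aC.
have [A0 rA0 sA0] : exists2 A, ring D ow (ar s NX) (ow a) (a :: A) &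
    (size A).+1 = size R.
  case: rR => U F M; have aR : a \in R by rewrite M aD eqxx.
  have [i q qE] := rot_to aR; exists q; last by rewrite -(size_rot i R) qE.
  rewrite -qE; split=> [||j]; rewrite ?rot_uniq ?mem_rot //.
  by rewrite rot_cycle.
pose scn := scanning (ar s NX) (ar s PT) C C1 a.
pose Inv k' s' := exists A B C2',
  [/\ scn A B C2' s', lv s' vs = head a B, (lv s' vt == 0) = (B == [::]) &
      K + 7 * (D - size (C1 ++ a :: C2')) + 30 * size B + 1 <= k'].
apply: wp_seq; apply: (@wp_conseq _ _ _ _ Inv).
  have : scn [::] A0 C2 (pexec s (Sub vx va vzero)).
    case: s S0 aE rA0 FC @scn @Inv {rR} => l h x y S0 /= aE rA0 FC.
    have o0 : l 11 = 0 := st_zero S0.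
    split=> //=.
    - by case: S0.
    - by move=> w; rewrite inE aE o0 subn0 => /eqP->.
    - by rewrite aE o0 subn0 mem_head.
  case: s S0 aE rA0 FC @scn @Inv {rR} => l h x y S0 /= aE rA0 FC sc0.
  have o0 : l 11 = 0 := st_zero S0.
  have NaE : h 0 a = head a A0.
    by case: rA0 => _ /=; case: (A0) => [|u A1] /= /andP[/eqP].
  have NaD : h 0 a < D by case: (rings_step (st_rings S0) aD).
  blk kK; rewrite aE; oks; exists [::], A0, C2; split=> //=.
  - by apply: scanning_eq sc0 _ _ _; rewrite //= aE !eqxx.
  - rewrite neq_eq0 NaE; case: (A0) rA0 => [|u A1] [/= U _ _]; first exact: eqxx.
    by move: U; rewrite inE negb_or eq_sym => /andP[/andP[/negPf->]].
  - by move: kK; rewrite /C -sA0; lia.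
move=> k1 s1 _ I1; apply: wp_while I1 => k' s' [A [B [C2' [sc sE tE kK']]]].
split; first by clear -kK'; lia.
rewrite tE; case: eqP => [B0|/eqP B0].
  by subst B; exists A, C2'; split=> //; lia.
case: B B0 sc sE tE kK' => // u B _ sc /= sE tE kK'.
(* The situation once [u] has been treated and counts as scanned, before [vs] moves on. *)
pose Mid k' s' := exists A C2', [/\ scn A B C2' s', lv s' vnext = head a B &
      K + 7 * (D - size (C1 ++ a :: C2')) + 30 * size B + 10 <= k'].
have [S' F' sub' rR' xP xA off ptE a'E] := sc.
have uD : u < D /\ ow u = ow a.
  case: rR' => _ _ /(_ u); rewrite !(inE, mem_cat) eqxx !orbT.
  by move=> /esym/andP[-> /eqP].
apply: wp_seq; case: s' S' F' sub' rR' xP xA off ptE a'E sc sE tE.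
move=> l h x y /= S' F' sub' rR' xP xA off ptE a'E sc sE tE.
have uE : h 0 u = head a B by case: rR' => _ F _; apply: fcycle_next F.
have /= mE := st_mark S'; have /= o0 := st_zero S'.
pose x0 := l 13; rewrite -/x0 in xP xA.
have aC' : a \in C1 ++ a :: C2' by rewrite mem_cat mem_head orbT.
have xD : x0 < D.
  case: rR' => _ _ /(_ x0); rewrite -cat_cons mem_cat xA.
  by move/esym/andP=> [].
blk kK'; oks; rewrite sE uE mE ?uD.1 //=.
apply: wp_seq; apply: (@wp_conseq _ _ _ _ Mid); last first.
  move=> k2 [l2 h2 x2 y2] _ [A2 [C3 [sc2 /= nE kk]]].
  have /= aE2 := sc_a sc2; have /= o02 := st_zero (sc_state sc2).
  have [U2 _ M2] := sc_ring sc2.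
  have nD : head a B < D.
    have : head a B \in a :: A2 ++ B.
      by case: (B) => [|w B'] /=; rewrite !(inE, mem_cat) eqxx ?orbT.
    by rewrite M2 => /andP[].
  blk kk; rewrite nE aE2 o02 subn0.
  have ? : head a B - a + (a - head a B) <= b by clear -nD aD Db; lia.
  oks; exists A2, B, C3; split=> //=.
  - by apply: scanning_eq sc2 _ _ _; rewrite //= !eqxx.
  - rewrite neq_eq0; case: (B) U2 => [|w B'] /=; first by rewrite !eqxx.
    by rewrite mem_cat inE !negb_or eq_sym => /andP[/and3P[_ /negPf-> _] _].
  - by clear -kk; lia.
apply: wp_if => /= [|uC|/eqP uC]; first by clear -kK'; lia.
  blk kK'; exists (rcons A u), C2'; split=> //; last by clear -kK'; lia.
  split=> //=.
  - by case: S'.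
  - by rewrite cat_rcons.
  - move=> w; rewrite inE mem_rcons inE orbCA -in_cons => /orP[/eqP->|wA wC].
      by move: uC; case: (u \in _).
    exact: xP.
  - by rewrite inE mem_rcons inE orbCA -in_cons xA orbT.
have uC' : u \notin C1 ++ a :: C2' by move: uC; case: (u \in _).
apply: wp_seq; blk kK'; oks; rewrite -/x0 mE //=.
(* If [vx] is marked, no scanned dart is off the cycle and [u] becomes the pending one; otherwise
   [vx] and [u] are exchanged with [a]. *)
apply: wp_if => /= [|xC|/eqP xC]; first by clear -kK'; lia.
  have {}xC : x0 \in C1 ++ a :: C2' by move: xC; case: (x0 \in _).
  blk kK'; oks; exists (rcons A u), C2'; split=> //; last by clear -kK'; lia.
  split=> //=; rewrite ?o0 ?sE ?subn0.
  - by case: S'.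
  - by rewrite cat_rcons.
  - move=> w; rewrite inE mem_rcons inE orbCA -in_cons => /orP[/eqP->//|wA wC].
    by move: (wC); rewrite (xP w wA wC) xC.
  - by rewrite inE mem_rcons mem_head orbT.
have {}xC : x0 \notin C1 ++ a :: C2' by move: xC; case: (x0 \in _).
have xa : x0 != a by apply: contraNneq xC => ->.
have xu : x0 != u.
  case: rR' => U _ _; apply: contraTneq U => xu.
  by rewrite -cat_cons cat_uniq -xu /= xA /= andbF.
have xA' : x0 \in A by move: xA; rewrite inE (negPf xa).
have [A' [rA' A'E]] := ring_exchange rR' xA'.
have rN' : rings D ow (exchange (h 0) a x0 u).
  apply: (rings_update (st_rings S') rA') => j jD ja; rewrite exchangeE //.
  rewrite !inE !negb_or; apply/and3P; split; apply: contraNneq ja => -> //.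
    by case: rR' => _ _ /(_ x0); rewrite -cat_cons mem_cat xA => /esym/andP[].
  by rewrite uD.2.
apply: wp_seq; blk kK'; oks; rewrite a'E -/x0 sE -uE.
set s3 := Store _ _ _ _.
have S1 : state (C1 ++ a :: C2') s3.
  by case: S' => /= *; split=> //=; apply: rN'.
apply: (@wp_conseq _ _ _ _ (marked (K + 30 * size B + 10) (C1 ++ a :: C2') s3)).
  by apply: mark_wp => //=; [rewrite a'E|clear -kK'; lia].
move=> k2 s2 _ [Z [S2 [UZ ZC] [FZ lZ] [NE PE lE] kk]].
rewrite /= a'E in FZ lZ.
have cC : cyc D T (h 0) (C1 ++ a :: C2').
  by split=> //; [exact: (st_uniq S')|exact: (st_lt S')].
have [[_ FC' _] uZ] :=
  cyc_exchange TP cC (st_rings S') rN' xD uD.1 xu xC uC' UZ ZC FZ lZ.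
have CZ w : (w \in C1 ++ a :: Z ++ C2') = (w \in C1 ++ a :: C2') || (w \in Z).
  by rewrite !(mem_cat, inE); do !case: (_ == _); do !case: (_ \in _).
have pZ : perm_eq ((C1 ++ a :: C2') ++ Z) (C1 ++ a :: Z ++ C2').
  by rewrite perm_catC perm_sym; apply: perm_splice.
exists A', (Z ++ C2'); split; last 1 first.
- have szE : size ((C1 ++ a :: C2') ++ Z) = size (C1 ++ a :: Z ++ C2') := perm_size pZ.
  by move: kk; rewrite szE; clear; lia.
- split; rewrite ?NE.
  + exact: state_perm pZ S2.
  + exact: FC'.
  + by move=> w /sub'; rewrite CZ => ->.
  + exact: rA'.
  (* The excursion contains [u], so [x0] remains the only candidate off the cycle. It may be on the
     excursion too, and its mark will then tell that nothing is pending. *)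
  + move=> w; rewrite inE A'E CZ negb_or inE orbCA -in_cons => wA /andP[wC wZ].
    rewrite lE //=; apply: (xP _ _ wC); case/orP: wA => // /eqP wu.
    by rewrite wu uZ in wZ.
  + by rewrite lE //= inE A'E inE xA' !orbT.
  + move=> j jD ja; rewrite -(off j jD ja); apply: exchangeE.
    rewrite !inE !negb_or; apply/and3P; split; apply: contraNneq ja => -> //.
      by case: rR' => _ _ /(_ x0); rewrite -cat_cons mem_cat xA => /esym/andP[].
    by rewrite uD.2.
  + by rewrite PE.
  + by rewrite lE.
by rewrite lE.
Qed.

Lemma fcycle_next_head (f : nat -> nat) a A p u q :
  fcycle f (a :: A) -> a :: A = p ++ u :: q -> f u = head a q.
Proof.
case: p => [|c p] F [aE AE]; last by rewrite AE in F; apply: fcycle_next F.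
by subst u q; move: F; case: (A) => [|w A'] /= /andP[/eqP].
Qed.

Lemma set_ports_wp K C a A s k :
  state C s -> lv s va = a -> ring D ow (ar s NX) (ow a) (a :: A) ->
  K + 8 * (size A).+1 + 5 <= k ->
  wp set_ports (fun k' s' =>
    [/\ state C s', ar s' NX = ar s NX, lv s' va = a,
        (forall i, i < size (a :: A) -> ar s' PT (nth 0 (a :: A) i) = i.+1) /\
        (forall j, j \notin a :: A -> ar s' PT j = ar s PT j) &
        K <= k']) k s.
Proof.
case: s => l h x y S /= aE rA kK.
have [U F M] := rA.
have sA : (size A).+1 <= D.
  by apply: (@size_below D (a :: A)) => // j; rewrite M => /andP[].
have /= o1 := st_one S; have /= o0 := st_zero S.
apply: wp_seq; blk kK; oks.
apply: (@wp_while _ _ _ (fun k' s' => exists A1 B,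
  [/\ a :: A = A1 ++ B /\ state C s', ar s' NX = h NX /\ lv s' va = a,
    [/\ lv s' vi = size A1, lv s' vs = head a B &
        (lv s' vt == 0) = (B == [::])],
    (forall i, i < size A1 -> ar s' PT (nth 0 (a :: A) i) = i.+1) /\
    (forall j, j \notin A1 -> ar s' PT j = h PT j) &
    K + 8 * size B + 1 <= k'])); last first.
  exists [::], (a :: A); split=> //=; last by clear -kK; lia.
  - by split=> //; case: S => *; split.
  - by rewrite aE o0 subn0.
move=> k' [l' h' x' y'] [A1 [B [[AE S'] [/= NE aE'] [iE sE tE] [pE nE] kK']]].
split; first by clear -kK'; lia.
rewrite tE; case: eqP => [B0|/eqP B0].
  move: AE; rewrite B0 cats0 => AE; rewrite -AE in pE nE.
  by split=> //; clear -kK'; lia.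
case: B B0 AE sE tE kK' => // u B _ AE /= sE tE kK'.
have /= o1' := st_one S'; have /= o0' := st_zero S'.
have uA : u \in a :: A by rewrite AE mem_cat mem_head orbT.
have nu : h 0 u = head a B := fcycle_next_head F AE.
have nD j : j \in a :: A -> j < D by rewrite M => /andP[].
have aD : a < D by apply: nD; rewrite mem_head.
have hD : head a B < D.
  apply: nD; rewrite AE mem_cat; case: (B) AE => [|w B'] AE /=; last by rewrite !inE eqxx !orbT.
  by rewrite -mem_cat -AE mem_head.
have sA1 : size A1 < (size A).+1.
  by rewrite -[(size A).+1]/(size (a :: A)) AE size_cat /=; clear; lia.
have uA1 : u \notin A1.
  by move: U; rewrite AE cat_uniq /= negb_or => /and3P[_ /andP[]].
blk kK'; rewrite o1' iE sE NE aE' nu addn1.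
have ? : size A1 < b by clear -sA sA1 Db; lia.
have ? : head a B - a + (a - head a B) <= b by clear -hD aD Db; lia.
oks; exists (rcons A1 u), B; split=> //=.
- by split; [rewrite cat_rcons|case: S' => *; split].
- split; rewrite ?size_rcons // neq_eq0.
  case: (B) AE => [|w B'] AE /=; first by rewrite !eqxx.
  apply: contraTF U => /eqP wa; rewrite AE wa.
  case: (A1) AE => [|c A1'] [-> AE]; rewrite /= !(inE, mem_cat) eqxx //.
  by rewrite !orbT.
- split=> [i|j].
    rewrite size_rcons ltnS => iA.
    have [->|ne] := eqVneq i (size A1).
      by rewrite AE nth_cat ltnn subnn /= eqxx.
    have iA1 : i < size A1 by rewrite ltn_neqAle ne.
    rewrite pE //; case: eqP => // e; case/negP: uA1; rewrite -e AE nth_cat iA1.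
    exact: mem_nth.
  by rewrite mem_rcons inE negb_or => /andP[/negPf-> /nE].
- by clear -kK'; lia.
Qed.

(** A visited node stays done, since later exchanges take place at other nodes and the cycle only
    grows. *)
Lemma done_sub N N' C C' pt pt' v : done D ow N C pt v ->
  (forall k, k < D -> ow k = v -> N' k = N k /\ pt' k = pt k) ->
  {subset C <= C'} -> done D ow N' C' pt' v.
Proof.
case=> R [rR pR [x xP]] NN CC; exists R; have [U F M] := rR.
have RR k : k \in R -> N' k = N k /\ pt' k = pt k.
  by rewrite M => /andP[kD /eqP]; apply: NN.
split.
- by apply: (ring_ext rR) => k /RR[].
- by move=> i iR; rewrite -pR //; case: (RR _ (mem_nth 0 iR)).
- by exists x => k kR kC; apply: xP => //; apply: contra kC; apply: CC.
Qed.

(** The default 1 makes [head 1 C = 0] exclude the empty list. Any nonzero port certifies that its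
    whole node is done. *)
Definition walked C s :=
  [/\ state C s, fcycle (sigma T (ar s NX)) C, head 1 C = 0 &
      forall k, k < D -> ar s PT k != 0 -> done D ow (ar s NX) C (ar s PT) (ow k)].

Lemma walked_eq C s s' : walked C s -> ar s' = ar s -> out s' = out s ->
  all (fun i => lv s' i == lv s i) [:: vone; vzero; vp; vcnt] -> walked C s'.
Proof.
case: s s' => [l h x y] [l' h' x' y'] [[/= s1 s2 s3 s4 s5 s6 s7 s8 s9 s10 s11 s12]].
move=> F h0 dn hh yy /= ll; subst h' y'.
move: ll => /and5P[/eqP l1 /eqP l2 /eqP l3 /eqP l4 _].
by split=> //=; split=> //=; rewrite ?l1 ?l2 ?l3 ?l4.
Qed.

(** The potential is 7 credits per unmarked dart, 60 per dart without a port, which pay for the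
    visit of its node, and 20 per dart not yet walked over. [C1] lists the darts walked over and
    [Pd] those with a port. *)
Lemma walk_wp K (C : seq nat) s k :
  walked C s -> lv s va = 0 -> (forall k, ar s PT k = 0) ->
  K + 7 * (D - size C) + 80 * D + 5 <= k ->
  wp walk (fun k' s' => K <= k' /\ exists C',
    [/\ walked C' s', lv s' va = 0 & forall k, k \in C' -> ar s' PT k != 0]) k s.
Proof.
case: s => l h x y [S F h0 dn] /= aE p0 kK.
pose Inv k' s' := exists C1 C2 Pd : seq nat,
  [/\ walked (C1 ++ C2) s',
      if lv s' vgo == 0 then C2 = [::] /\ lv s' va = 0
      else exists C3, C2 = lv s' va :: C3,
      forall k, k \in C1 -> ar s' PT k != 0,
      uniq Pd /\ forall k, (k \in Pd) = (k < D) && (ar s' PT k != 0) &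
      K + 7 * (D - size (C1 ++ C2)) + 60 * (D - size Pd) +
      20 * (D - size C1) + 1 <= k'].
apply: wp_seq; apply: (@wp_conseq _ _ _ _ Inv).
  blk kK; split; first by clear -Db; lia.
  exists [::], C, [::]; split=> //=.
  - by split=> //; case: S => *; split.
  - by rewrite aE; case: (C) h0 => //= c C' ->; exists C'.
  - by split=> // j; rewrite p0 eqxx andbF.
  - by clear -kK; lia.
move=> k1 s1 _ I0; apply: wp_while I0.
clear -TP Db; move=> k [l h x y] [C1 [C2 [Pd [W /= goE C1P [UPd PdP] kK]]]].
split; first by clear -kK; lia.
case: ifP goE => [_ [C20 a0]|_ [C3 C2E]].
  split; first by clear -kK; lia.
  by exists C1; rewrite C20 cats0 in W; split.
set a := l 12 in C2E.
subst C2.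
pose Mid k' s' := exists C1 C3 Pd : seq nat,
  [/\ walked (C1 ++ a :: C3) s', lv s' va = a /\ ar s' PT a != 0,
      forall k, k \in C1 -> ar s' PT k != 0,
      uniq Pd /\ forall k, (k \in Pd) = (k < D) && (ar s' PT k != 0) &
      K + 7 * (D - size (C1 ++ a :: C3)) + 60 * (D - size Pd) +
      20 * (D - (size C1).+1) + 6 <= k'].
have sC1 : size C1 < D.
  have [S' _ _ _] := W.
  have := size_below (st_uniq S') (@st_lt _ _ S').
  by rewrite size_cat /=; clear; lia.
have sPd : size Pd <= D by apply: size_below => // j; rewrite PdP => /andP[].
have aC : a \in C1 ++ a :: C3 by rewrite mem_cat mem_head orbT.
have aD : a < D by case: W => S' _ _ _; apply: (st_lt S').
have {}kK : K + 7 * (D - size (C1 ++ a :: C3)) + 60 * (D - size Pd) +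
      20 * (D - (size C1).+1) + 21 <= k by clear -sC1 kK; lia.
apply: wp_seq; blk kK; oks; rewrite -/a.
apply: wp_seq; apply: (@wp_conseq _ _ _ _ Mid); last first.
  move=> k2 [l2 h2 x2 y2] _ [C1' [C4 [Pd' [W' /= [aE' pa] C1P' Pd'P kk]]]].
  have [S' F' h0' _] := W'.
  have sE : sigma T (h2 0) a = if C4 is c :: _ then c else 0.
    move: F'; rewrite cycle_catC /= rcons_cat.
    case: (C4) => [|c C4'] /=; last by case/andP=> /eqP.
    by move: h0'; case: (C1') => [|c C'] /= c0 /andP[/eqP ->]; rewrite c0.
  blk kk; have /= TE := st_T S'; rewrite aE' TE -/(sigma T (h2 0) a); oks.
  exists (rcons C1' a), C4, Pd'; split=> //=.
  - by rewrite cat_rcons; apply: walked_eq W' _ _ _; rewrite //= !eqxx.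
  (* Dart 0 heads the cycle and occurs in it once, so the next dart is 0 exactly when the walk is
     over. *)
  - have /= o0 := st_zero S'; rewrite o0 subn0 sE.
    case: (C4) S' h0' => [|c C4'] S' h0' //=; case: eqP => [c0|_]; last by exists C4'.
    have := st_uniq S'; rewrite c0 -(cat_rcons a) cat_uniq /= negb_or.
    case: (C1') h0' => [|c' C] /= z0; rewrite !inE ?z0 ?eqxx /= ?andbF //.
  - by move=> j; rewrite mem_rcons inE => /orP[/eqP->//|/C1P'].
  - by rewrite cat_rcons size_rcons; clear -kk; lia.
apply: wp_if => /= [|tn|t0]; first by clear -kK; lia.
  blk kK; exists C1, C3, Pd; split=> //=.
    by apply: walked_eq W _ _ _; rewrite //= !eqxx.
  by clear -kK sC1; lia.
have [S F h0 dn] := W.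
have /= [R rR] := st_rings S aD; have [UR FR MR] := rR.
(* If one dart of the node had a port, the node would be done and [a] would have one too. *)
have pR j : j \in R -> h 3 j = 0.
  rewrite MR => /andP[jD /eqP ja]; apply/eqP/negPn/negP => pj.
  have [R' [[_ _ MR'] pR' _]] := dn _ jD pj.
  have : a \in R' by rewrite MR' aD ja eqxx.
  by rewrite -index_mem => ai; move: (pR' _ ai); rewrite nth_index -?index_mem //= t0.
(* The ring is disjoint from the darts with ports, so its visit releases exactly [60 * size R]
   credits. *)
have sR : size R + size Pd <= D.
  rewrite -size_cat; apply: size_below => [|j].
    rewrite cat_uniq UR UPd andbT; apply/hasPn => j; rewrite PdP => /andP[_ pj].
    by apply/negP => /pR /eqP; rewrite (negPf pj).
  by rewrite mem_cat MR PdP => /orP[] /andP[].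
have R0 : 0 < size R.
  have : a \in R by rewrite MR aD eqxx.
  by case: (R).
(* What must remain after the visit, apart from the credits of unmarked darts: [R] now has ports,
   and six credits serve to move on. *)
pose X := K + 60 * (D - (size R + size Pd)) + 20 * (D - (size C1).+1) + 6.
apply: wp_seq.
set s1 := Store _ _ _ _.
have [S1 _ _ _] : walked (C1 ++ a :: C3) s1.
  by apply: walked_eq W _ _ _; rewrite //= !eqxx.
apply: wp_conseq (scan_wp (K := X + 8 * size R + 5) S1 F erefl rR _) _.
  by rewrite /X; clear -kK sR sC1 R0; lia.
move=> k1 s2 _ [A [C3' [sc kk]]].
have [S2 F2 sub2 rA xA _ off pE aE] := sc.
rewrite cats0 in rA; have [UA FA MA] := rA.
have szA : (size A).+1 = size R.
  rewrite -[LHS]/(size (a :: A)); apply/perm_size/uniq_perm => // j.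
  by rewrite MA MR.
apply: wp_conseq (set_ports_wp (K := X + 7 * (D - size (C1 ++ a :: C3'))) S2 aE rA _) _.
  by rewrite szA; clear -kk; lia.
move=> k2 s3 _ [S3 NE aE3 [pA nA] kk2].
have pO j : ow j != ow a -> ar s3 3 j = h 3 j.
  move=> ja; rewrite nA ?pE //; apply/negP.
  by rewrite MA (negPf ja) andbF.
have pA0 j : j \in a :: A -> ar s3 3 j != 0.
  move=> jA; rewrite -(nth_index 0 jA) pA ?index_mem //.
exists C1, C3', (R ++ Pd); split=> //=.
- split; rewrite ?NE //.
    by case: (C1) h0.
  move=> j jD pj; have [ja|ja] := eqVneq (ow j) (ow a).
    rewrite ja; exists (a :: A); split=> //.
    by exists (lv s2 13).
  apply: (done_sub (dn j jD _)) => //=; first by rewrite -pO.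
  by move=> i iD ij; rewrite off ?pO ?ij.
- by split=> //; apply: pA0; rewrite mem_head.
- move=> j jC; have [ja|ja] := eqVneq (ow j) (ow a); last by rewrite pO // C1P.
  apply: pA0; rewrite MA ja eqxx andbT.
  by apply: (st_lt S); rewrite mem_cat jC.
- split.
    rewrite cat_uniq UR UPd andbT; apply/hasPn => j; rewrite PdP => /andP[_ pj].
    by apply/negP => /pR /eqP; rewrite (negPf pj).
  move=> j; rewrite mem_cat MR PdP -andb_orr; case: (ltnP j D) => //= jD.
  case: eqP => [ja|/eqP ja] /=; last by rewrite pO.
  by apply/esym/pA0; rewrite MA jD ja eqxx.
- by rewrite (size_cat R); move: kk2; rewrite /X; clear; lia.
Qed.

(** Nothing is marked at first, not even dart 0, so the marked path runs round the whole cycle and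
    ends at 0; moving 0 to the front gives the cycle. *)
Lemma mark_start_wp K k s : state [::] s -> lv s va = 0 ->
  (forall k, ar s PT k = 0) -> 0 < D ->
  K + 7 * D + 8 <= k ->
  wp mark (fun k' s' => exists C,
    [/\ walked C s', lv s' va = 0 /\ ar s' PT = ar s PT &
        K + 7 * (D - size C) <= k']) k s.
Proof.
move=> S aE p0 D0 kK.
have kK2 : K + 7 * (D - size (Nil nat)) + 8 <= k by rewrite subn0.
apply: wp_conseq (mark_wp S _ kK2) _; first by rewrite aE.
move=> k' s' _ [Z [S' [UZ ZD] [FZ lZ] [NE PE lE] kk]]; rewrite /= aE in S' FZ lZ kk.
have Zlt j : j \in 0 :: Z -> j < D.
  by rewrite inE => /orP[/eqP->|/ZD[]].
have inj : {in 0 :: Z &, injective (sigma T (ar s NX))}.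
  by move=> i j /Zlt iD /Zlt jD; apply: (sigma_inj TP (st_rings S)).
have [q Fq Zq] := fcycle_close UZ inj FZ lZ.
have pq : perm_eq Z (0 :: q) by rewrite Zq perm_rcons.
have szq : size Z = size (0 :: q) := perm_size pq.
exists (0 :: q); split; last by rewrite -szq.
- split=> //; first exact: state_perm pq S'.
    by rewrite NE.
  by move=> j jD; rewrite PE p0.
- by rewrite lE.
Qed.

Lemma write_ports_wp K C k s : state C s -> K + 5 * D + 4 <= k ->
  wp write_ports (fun k' s' =>
    [/\ K <= k', ar s' = ar s, out s' = [seq ar s PT j | j <- iota 0 D] &
        forall i, i \notin [:: vq; vt; vu] -> lv s' i = lv s i]) k s.
Proof.
case: s => l h x y S kK.
have [/= o1 o0 op oc hT how hhd oy rN hM UC CD] := S.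
apply: wp_seq; blk kK; oks; rewrite op subn0.
apply: (@wp_while _ _ _ (fun k' s' => exists2 q, q <= D &
  [/\ ar s' = h, lv s' vq = q /\ lv s' vt = D - q,
      out s' = [seq h PT j | j <- iota 0 q],
      forall i, i \notin [:: vq; vt; vu] -> lv s' i = l i &
      K + 5 * (D - q) + 1 <= k'])); last first.
  exists 0 => //; split=> //=; [by rewrite subn0| |by clear -kK; lia].
  by move=> i; rewrite !inE !negb_or => /and3P[/negPf-> /negPf-> _].
move=> k' [l' h' x' y'] [q qD [/= -> [qE tE] -> lE kK']].
split; first by clear -kK'; lia.
rewrite tE subn_eq0; case: (leqP D q) => [Dq|{}qD].
  have {qD Dq} -> : q = D by apply/eqP; rewrite eqn_leq qD Dq.
  by split=> //; clear -kK'; lia.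
have kK2 : 4 <= k'.-1 by clear -kK' qD; lia.
blk kK2; rewrite qE (lE 10) // o1 addn1 (lE 1) // op.
have ? : q.+1 <= b by clear -qD Db; lia.
oks; exists q.+1 => //; split=> //=.
- have iE : iota 0 q.+1 = rcons (iota 0 q) q by rewrite -addn1 iotaD cats1.
  by rewrite -map_rcons -iE.
- by move=> i ii; rewrite -(lE i ii); move: ii; rewrite !inE !negb_or
    => /and3P[/negPf-> /negPf-> /negPf->].
- by clear -kK' qD; lia.
Qed.

Lemma write_cycle_wp K (C : seq nat) k (s : store) :
  fcycle (sigma T (ar s NX)) C -> uniq C -> head 1 C = 0 ->
  ar s TW = T -> ar s OW = ow -> ar s HD = hd ->
  lv s va = 0 -> lv s vcnt = size C -> lv s vzero = 0 ->
  K + 9 * size C + 4 <= k ->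
  wp write_cycle (fun k' s' =>
    out s' = out s ++ size C :: flatten [seq [:: hd j; ow j] | j <- C]) k s.
Proof.
case: s => l h x y /= F U h0 TE oE hE aE cE zE kK.
apply: wp_seq; blk kK; split=> //; split; first by clear -Db; lia.
apply: (@wp_while _ _ _ (fun k' s' => exists C1 C2,
  [/\ C = C1 ++ C2, ar s' = h /\ lv s' vzero = 0,
      if lv s' vgo == 0 then C2 = [::] else exists C3, C2 = lv s' va :: C3,
      out s' = y ++ size C :: flatten [seq [:: hd j; ow j] | j <- C1] &
      K + 9 * size C2 + 1 <= k'])); last first.
  exists [::], C; split=> //=.
  - by rewrite aE; case: (C) h0 => //= c C' ->; exists C'.
  - by rewrite cE cats1.
  - by clear -kK; lia.
move=> k' [l' h' x' y'] [C1 [C2 [CE [/= -> zE'] goE -> kK']]].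
split; first by clear -kK'; lia.
case: ifP goE => [_ C20|_ [C3 C2E]].
  by rewrite C20 cats0 in CE; rewrite /= CE.
set a := l' 12 in C2E; subst C2; rewrite /= in kK'.
have sE : sigma T (h 0) a = if C3 is c :: _ then c else 0.
  move: F; rewrite CE cycle_catC /= rcons_cat.
  case: (C3) CE => [|c C4'] CE /=; last by case/andP=> /eqP.
  by move: h0; rewrite CE; case: (C1) => [|c C'] /= c0 /andP[/eqP ->]; rewrite c0.
blk kK'; rewrite -/a TE -/(sigma T (h 0) a) zE' subn0 oE hE; oks.
exists (rcons C1 a), C3; split=> //=.
- by rewrite cat_rcons.
- rewrite sE; case: (C3) CE => [|c C4] CE //=; case: eqP => [c0|_]; last by exists C4.
  move: U h0; rewrite CE c0 -(cat_rcons a) cat_uniq /= negb_or.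
  by case: (C1) => [|c' C'] /= + z0; rewrite !inE ?z0 ?eqxx /= ?andbF.
- by rewrite map_rcons flatten_rcons -!cats1 -!catA.
- by clear -kK'; lia.
Qed.
End Walk.

(** * Reading the graph *)

(** A dart is a pair of owner and head, and its number is its position in this list. *)
Fixpoint darts (j : nat) (rows : seq (seq nat)) : seq (nat * nat) :=
  if rows is r :: rs then [seq (j, u) | u <- r] ++ darts j.+1 rs else [::].

Definition rows_code (rows : seq (seq nat)) : seq nat :=
  flatten [seq size r :: r | r <- rows].

Lemma darts_cat j rs rs' :
  darts j (rs ++ rs') = darts j rs ++ darts (j + size rs) rs'.
Proof.
elim: rs j => [|r rs IH] j /=; first by rewrite addn0.
by rewrite IH catA addSnnS.
Qed.

Lemma mem_darts j rs w : w \in darts j rs ->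
  j <= w.1 < j + size rs /\ w.2 \in nth [::] rs (w.1 - j).
Proof.
case: w => v u; elim: rs j => [|r rs IH] j //=; rewrite mem_cat => /orP[].
  by case/mapP=> u' ur [-> ->]; rewrite subnn; split=> //; clear; lia.
move=> /IH[/= vj ur]; have -> : v - j = (v - j.+1).+1 by clear -vj; lia.
by split=> //; clear -vj; lia.
Qed.

Lemma darts_uniq j rs : all uniq rs -> uniq (darts j rs).
Proof.
elim: rs j => [|r rs IH] j //= /andP[Ur Urs]; rewrite cat_uniq IH // andbT.
rewrite map_inj_uniq ?Ur => [|u v [] //].
apply/hasPn => w /mem_darts[wj _]; apply/mapP => -[u _ wE].
by move: wj; rewrite wE /= ltnn.
Qed.

Lemma fpath_iota (f : nat -> nat) p d q :
  (forall k, p <= k < p + d -> f k = k.+1) -> f (p + d) = q ->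
  fpath f p (rcons (iota p.+1 d) q).
Proof.
elim: d p => [|d IH] p fS fq /=; first by rewrite -fq addn0 eqxx.
rewrite fS ?eqxx /=; last by clear; lia.
by apply: IH => [k kp|]; [apply: fS; clear -kp; lia|rewrite addSnnS].
Qed.

Section Input.
Variables (P : program) (b : nat) (final : config -> Prop).
Variables (n : nat) (rows : seq (seq nat)).
Hypotheses (szr : size rows = n) (rne : [::] \notin rows)
  (rlt : all (all (gtn n)) rows) (rU : all uniq rows).
Notation dd := (darts 0 rows).
Notation D := (size dd).
Notation ow := (fun k => (nth (0, 0) dd k).1).
Notation hd := (fun k => (nth (0, 0) dd k).2).
Hypotheses (Db : D < b) (nb : n * n + n <= b).
Notation wp := (wp P b final).

Lemma dart_lt k : k < D -> ow k < n /\ hd k < n.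
Proof.
move=> kD; have [] := mem_darts (mem_nth (0, 0) kD).
rewrite /= subn0 add0n szr => kn hr; split=> //.
have rin : nth [::] rows (ow k) \in rows by rewrite mem_nth ?szr.
exact: (allP (allP rlt _ rin)).
Qed.

(** Distinct darts use distinct cells of the matrix, so recording a dart never overwrites an earlier
    one. *)
Lemma dart_code_inj j k : j < D -> k < D ->
  ow j * n + hd j = ow k * n + hd k -> j = k.
Proof.
move=> jD kD e; have [_ hj] := dart_lt jD; have [_ hk] := dart_lt kD.
have n0 : 0 < n by apply: leq_ltn_trans hj.
have eo : ow j = ow k.
  by move: (congr1 (divn^~ n) e); rewrite !divnMDl // !divn_small // !addn0.
have eh : hd j = hd k by move: e; rewrite eo => /addnI.
apply/eqP; rewrite -(nth_uniq (0, 0) jD kD (darts_uniq 0 rU)).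
by rewrite -pair_eqE /pair_eq /= eo eh !eqxx.
Qed.

Record read_upto p v (s : store) : Prop := ReadUpto {
  rd_one : lv s vone = 1;
  rd_zero : lv s vzero = 0;
  rd_n : lv s vn = n;
  rd_p : lv s vp = p;
  rd_v : lv s vv = v;
  rd_row : lv s vrow = v * n;
  rd_a : lv s va = 0;
  rd_cnt : lv s vcnt = 0;
  rd_out : out s = [::];
  rd_MK : forall k, ar s MK k = 0;
  rd_PT : forall k, ar s PT k = 0;
  rd_data : forall k, k < p ->
    [/\ ar s OW k = ow k, ar s HD k = hd k & ar s MX (ow k * n + hd k) = k] }.

Definition read_rows pre (s : store) :=
  [/\ read_upto (size (darts 0 pre)) (size pre) s,
      forall j, j < size pre -> ar s RW j = j * n &
      forall j, j < size pre ->
        exists R, ring (size (darts 0 pre)) ow (ar s NX) j R].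

(** Each dart is linked to the next number, the last one included; its link is corrected after the
    loop. *)
Lemma read_row_wp K pre r post k s : rows = pre ++ r :: post ->
  let p0 := size (darts 0 pre) in let v := size pre in
  read_upto p0 v s -> inp s = r ++ rows_code post -> lv s vd = size r ->
  K + 11 * size r + 1 <= k ->
  wp (While vd
           (Blk [:: Rd vu; Put OW vp vv; Put HD vp vu; Add vq vrow vu;
                    Put MX vq vp; Sub vd vd vone; Add vq vp vone;
                    Put NX vp vq; mov vlast vp; mov vp vq]))
    (fun k' s' => [/\ read_upto (p0 + size r) v s', inp s' = rows_code post,
        [/\ ar s' RW = ar s RW, lv s' vfirst = lv s vfirst &
            0 < size r -> lv s' vlast = p0 + (size r).-1],
        forall j, ar s' NX j =
          if p0 <= j < p0 + size r then j.+1 else ar s NX j & K <= k']) k s.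
Proof.
move=> rE p0 v S iE dE kK.
have ddE : dd = darts 0 pre ++ [seq (v, u) | u <- r] ++ darts v.+1 post.
  by rewrite rE darts_cat.
have qP i : i < size r -> [/\ p0 + i < D, ow (p0 + i) = v & hd (p0 + i) = nth 0 r i].
  move=> ir; rewrite ddE !size_cat size_map -/p0; split; first by clear -ir; lia.
    by rewrite nth_cat ltnNge leq_addr /= addKn nth_cat size_map ir (nth_map 0).
  by rewrite nth_cat ltnNge leq_addr /= addKn nth_cat size_map ir (nth_map 0).
apply: (@wp_while _ _ _ (fun k' s' => exists2 i, i <= size r &
   [/\ read_upto (p0 + i) v s',
       inp s' = drop i r ++ rows_code post /\ lv s' vd = size r - i,
       [/\ ar s' RW = ar s RW, lv s' vfirst = lv s vfirst &
            0 < i -> lv s' vlast = p0 + i.-1],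
       forall j, ar s' NX j =
          if p0 <= j < p0 + i then j.+1 else ar s NX j &
       K + 11 * (size r - i) + 1 <= k'])); last first.
  exists 0 => //; split=> //; rewrite ?addn0 ?drop0 ?subn0 //.
  by move=> j; case: ifP => //; clear; lia.
move=> k' [l h x y] [i ir [S' [/= xE d'E] [RE fE lE] NE kK']].
split; first by clear -kK'; lia.
rewrite d'E subn_eq0; case: (leqP (size r) i) => [ri|{}ir].
  have irE : i = size r by apply/eqP; rewrite eqn_leq ir ri.
  rewrite irE in S' xE lE NE; rewrite drop_size in xE.
  by split=> //; clear -kK'; lia.
have [/= o1 o0 onn op ov orow oa oc oy M0 P0 dat] := S'.
have [qD owq hdq] := qP i ir.
have [vN uN] := dart_lt qD; rewrite owq hdq in vN uN.
have xE' : x = nth 0 r i :: (drop i.+1 r ++ rows_code post).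
  by rewrite xE (drop_nth 0 ir).
have kK2 : 10 <= k'.-1 by clear -kK' ir; lia.
blk kK2; rewrite xE' /= o1 o0 op ov orow d'E !subn0 addn1.
have vnb : v * n + nth 0 r i <= b.
  have : v.+1 * n <= n * n by rewrite leq_mul2r vN orbT.
  by move: nb uN; clear; rewrite mulSn; lia.
oks; exists i.+1 => //; split=> //=.
- split=> //=; rewrite ?addnS // => c; rewrite ltnS leq_eqVlt => /orP[/eqP->|cp].
    by rewrite eqxx owq hdq eqxx.
  have [E1 E2 E3] := dat c cp.
  rewrite (ltn_eqF cp); split=> //; case: eqP => // e.
  have cD : c < D := ltn_trans cp qD.
  have := dart_code_inj cD qD; rewrite owq hdq => /(_ e) cE.
  by rewrite cE ltnn in cp.
- by split=> //; clear -ir; lia.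
- move=> j; rewrite addnS ltnS; case: eqP => [->|/eqP jp].
    by rewrite leq_addr leqnn.
  by rewrite NE [j <= _]leq_eqVlt (negPf jp).
- by clear -kK' ir; lia.
Qed.

Lemma read_graph_wp K k x : x = n :: rows_code rows ->
  K + 11 * D + 10 * n + 5 <= k ->
  wp read_graph (fun k' s' => read_rows rows s' /\ K <= k')
    k (Store (fun=> 0) (fun _ _ => 0) x [::]).
Proof.
move=> -> kK; apply: wp_seq; blk kK; oks; rewrite subn0.
apply: (@wp_while _ _ _ (fun k' s' => exists pre post,
  [/\ rows = pre ++ post, read_rows pre s', inp s' = rows_code post,
      lv s' vt = n - size pre &
      K + 11 * (D - size (darts 0 pre)) + 10 * size post + 1 <= k'])); last first.
  exists [::], rows; split=> //=; rewrite ?subn0 //.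
  by rewrite szr; clear -kK; lia.
move=> k' [l h z y] [pre [post [rE [S RE rg] /= zE tE kK']]].
split; first by clear -kK'; lia.
have np : n = size pre + size post by rewrite -szr rE size_cat.
rewrite tE np addKn; case: post rE zE kK' np => [|r post] rE zE kK' np.
  by rewrite cats0 in rE; rewrite /= rE; split=> //; clear -kK'; lia.
have [/= o1 o0 onn op ov orow oa oc oy M0 P0 dat] := S.
have {}RE j : j < size pre -> h 7 j = j * n := RE j.
have {}rg j := rg j; rewrite /= in rg.
(* A nonempty row guarantees that [vlast] is a dart of this row. *)
have r0 : 0 < size r.
  rewrite lt0n size_eq0; apply: contraNneq rne => <-.
  by rewrite rE mem_cat mem_head orbT.
have pD : size (darts 0 pre) + size r <= D.
  by rewrite rE darts_cat /= !size_cat size_map; clear; lia.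
rewrite /= in zE kK' np *.
apply: wp_seq; blk kK'; oks; rewrite zE /= ov orow op o0 subn0.
set s1 := Store _ _ _ _.
apply: wp_seq.
have kK2 : K + 11 * (D - (size (darts 0 pre) + size r)) + 10 * size post + 6 +
  11 * size r + 1 <= k'.-1 - 3 by move: kK' pD; rewrite /=; clear; lia.
apply: wp_conseq (read_row_wp rE (s := s1) _ _ _ kK2) _ => //.
move=> {kK2} k2 [l2 h2 x2 y2] _ [S2 iE [/= RE2 fE lE] NE kk].
have [/= o12 o02 onn2 op2 ov2 orow2 oa2 oc2 oy2 M02 P02 dat2] := S2.
have lE2 := lE r0.
have rsz : size (rcons pre r) <= n by rewrite -szr rE size_cat size_rcons /=; clear; lia.
have vE : size pre + 1 = size (rcons pre r) by rewrite size_rcons addn1.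
have pE : size (darts 0 pre) + size r = size (darts 0 (rcons pre r)).
  by rewrite -cats1 darts_cat /= !size_cat size_map addn0.
blk kk; rewrite o12 onn2 ov2 orow2 fE lE2 vE.
have vb : size pre * n + n <= b.
  have : (size pre).+1 * n <= n * n.
    by rewrite leq_mul2r -addn1 vE rsz orbT.
  by move: nb; clear; rewrite mulSn; lia.
have vb1 : size (rcons pre r) <= b by move: rsz nb; clear; lia.
oks; exists (rcons pre r), post; rewrite -pE; split=> //=.
- by rewrite cat_rcons.
- set p0 := size (darts 0 pre) in pE NE S2 *.
  (* Among the darts read so far, those of the current row are the ones numbered from [p0] on. *)
  have owP c : c < p0 + size r -> (size pre <= ow c) = (p0 <= c) /\ ow c <= size pre.
    move=> cp; rewrite rE darts_cat nth_cat -/p0; case: ltnP => [cp0|pc].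
      have [] := mem_darts (mem_nth (0, 0) cp0) => /= cv _.
      by rewrite add0n in cv; rewrite leqNgt cv ltnW.
    rewrite /= nth_cat size_map; have cr : c - p0 < size r by move: cp pc; clear; lia.
    by rewrite cr (nth_map 0) //= leqnn.
  split=> /=.
  + split=> //=; [by rewrite -pE|by rewrite size_rcons mulSn addnC|by rewrite -pE].
  + move=> j; rewrite size_rcons ltnS leq_eqVlt RE2 /= => /orP[/eqP->|jv].
      by rewrite eqxx.
    by rewrite (ltn_eqF jv) RE.
  rewrite -pE => j; rewrite size_rcons ltnS leq_eqVlt => /orP[/eqP->|jv].
    exists (iota p0 (size r)); split; first exact: iota_uniq.
      case: (size r) r0 NE => // d _ NE.
      apply: fpath_iota => [c cp|]; last by rewrite /= ?eqxx.
      rewrite /= NE; case: eqP => [ce|_]; first by move: cp; rewrite ce ltnn andbF.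
      by case: ifP => // /negP[]; move: cp; clear; lia.
    move=> c; rewrite mem_iota andbC; case: ltnP => //= cp.
    by have [<- le] := owP c cp; rewrite eqn_leq le.
  have [R [UR FR MR]] := rg j jv; exists R; split=> // [|c].
    rewrite -(@eq_in_cycle _ (mem R) (frel (h 0))) //=.
      move=> c c' cR _ /=; have : c < p0 by move: (cR : c \in R); rewrite MR => /andP[].
      move=> cp; rewrite NE leqNgt cp /=.
      by have -> : (c == p0 + (size r).-1) = false by move: cp; clear; lia.
  rewrite MR -/p0; case: (ltnP c p0) => cp.
    by rewrite ltn_addr.
  case: ltnP => //= cp'; apply/esym/negP => /eqP cj.
  by have [+ _] := owP c cp'; rewrite cj leqNgt jv cp.
- by rewrite np.
- by clear -kk; lia.
Qed.


Hypotheses (D0 : 0 < D) (dsym : forall k, k < D -> (hd k, ow k) \in dd).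
Notation T := (fun k => index (hd k, ow k) dd).

Lemma twinP k : k < D -> [/\ T k < D, T (T k) = k & ow (T k) = hd k].
Proof.
move=> kD; have Tk : T k < D by rewrite index_mem dsym.
have nT : nth (0, 0) dd (T k) = (hd k, ow k) by rewrite nth_index ?dsym.
split=> //; rewrite nT //= -surjective_pairing index_uniq //.
exact: darts_uniq.
Qed.

(** The arrays describe the graph only below [D], whereas [state] fixes them as functions; hence the
    auxiliary [ow'], [hd'] and [T']. *)
Lemma find_twins_wp K k s : read_rows rows s -> K + 9 * D + 4 <= k ->
  wp find_twins (fun k' s' => K <= k' /\ exists ow' hd' T',
    [/\ state D ow' hd' T' [::] s',
        forall j, j < D -> [/\ ow' j = ow j, hd' j = hd j & T' j = T j],
        lv s' va = 0 & forall j, ar s' PT j = 0]) k s.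
Proof.
case: s => l h x y [S /= RE rg] kK.
have [/= o1 o0 onn op ov orow oa oc oy M0 P0 dat] := S.
apply: wp_seq; blk kK; oks; rewrite op subn0.
apply: (@wp_while _ _ _ (fun k' s' => exists2 q, q <= D &
  [/\ forall f, f != TW -> ar s' f = h f,
      [/\ lv s' vq = q, lv s' vt = D - q & out s' = [::]],
      forall j, j < q -> ar s' TW j = T j,
      forall i, i \notin [:: vq; vt; vu; vv; vd] -> lv s' i = l i &
      K + 9 * (D - q) + 1 <= k'])); last first.
  exists 0 => //; split=> //=; [by rewrite subn0| |by clear -kK; lia].
  by move=> i; rewrite !inE !negb_or => /and5P[/negPf-> /negPf->].
move=> k' [l' h' x' y'] [q qD [/= hE [qE tE yE] TE lE kK']].
split; first by clear -kK'; lia.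
rewrite tE subn_eq0; case: (leqP D q) => [Dq|{}qD].
  have {Dq}qD : q = D by apply/eqP; rewrite eqn_leq qD Dq.
  rewrite qD in TE; split; first by clear -kK'; lia.
  exists (h OW), (h HD), (h' TW); split=> /=.
  - split=> //=; rewrite ?lE ?hE // => j jD.
      have [E1 _ _] := dat j jD; rewrite E1.
      have [|R [UR FR MR]] := rg (ow j); first by rewrite szr; case: (dart_lt jD).
      exists R; split=> // c; rewrite MR; case: ltnP => //= cD.
      by have [-> _ _] := dat c cD.
  - by move=> j jD; have [-> -> _] := dat j jD; rewrite TE.
  - by rewrite lE.
  - by move=> j; rewrite hE.
have kK2 : 8 <= k'.-1 by clear -kK' qD; lia.
have [Tq TTq oT] := twinP qD; have [oq hq] := dart_lt qD.
have [E1 E2 _] := dat q qD; have [_ _ E3] := dat _ Tq.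
have hT : hd (T q) = ow q by rewrite nth_index ?dsym.
have vnb : hd q * n + ow q <= b.
  have : (hd q).+1 * n <= n * n by rewrite leq_mul2r hq orbT.
  by move: nb oq; clear; rewrite mulSn; lia.
rewrite /= oT hT in E3.
blk kK2; rewrite qE (lE 10) // o1 addn1 (lE 1) // op.
rewrite (hE HD) // (hE OW) // (hE RW) // (hE MX) // E2 E1 RE ?szr //= E3.
have ? : q.+1 <= b by clear -qD Db; lia.
oks; exists q.+1 => //; split=> //=.
- by move=> f f1; rewrite (negPf f1) hE.
- move=> j; rewrite ltnS leq_eqVlt; case: eqP => [->//|_] /= jq.
  exact: TE.
- by move=> i ii; rewrite -(lE i ii); move: ii; rewrite !inE !negb_or
    => /and5P[/negPf-> /negPf-> /negPf-> /negPf-> /negPf->].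
- by clear -kK' qD; lia.
Qed.

Definition solution N pt C y :=
  [/\ rings D ow N, cyc D T N C, head 1 C = 0,
      forall k, k \in C -> done D ow N C pt (ow k) &
      y = [seq pt j | j <- iota 0 D] ++
          size C :: flatten [seq [:: hd j; ow j] | j <- C]].

Lemma witness_cmd_wp x k : x = n :: rows_code rows ->
  200 * D + 10 * n + 100 <= k ->
  wp witness_cmd (fun _ s => exists N pt C, solution N pt C (out s))
    k (Store (fun=> 0) (fun _ _ => 0) x [::]).
Proof.
move=> xE kK; apply: wp_seq.
(* Here and below [K] is chosen so that each phase leaves enough credits for the remaining ones. *)
apply: wp_conseq (read_graph_wp (K := 189 * D + 90) xE _) _.
  by clear -kK; lia.
move=> {kK} k1 s1 _ [r1 k1K]; apply: wp_seq.
apply: wp_conseq (find_twins_wp (K := 180 * D + 80) r1 _) _.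
  by clear -k1K; lia.
move=> {k1K r1 s1 k1} k s _ [kK [ow' [hd' [T' [S E aE pE]]]]].
have TP j : j < D -> [/\ T' j < D, T' (T' j) = j & ow' (T' j) = hd' j].
  move=> jD; have [tD tt to] := twinP jD.
  by have [_ -> ->] := E j jD; have [-> _ ->] := E _ tD.
apply: wp_seq.
apply: wp_conseq (mark_start_wp TP Db (K := 170 * D + 70) S aE pE D0 _) _.
  by clear -kK; lia.
move=> {kK S aE} k1 s1 _ [C1 [W1 [a1 p1] kK]]; apply: wp_seq.
apply: wp_conseq (walk_wp TP Db (K := 90 * D + 60) W1 a1 _ _) _.
- by rewrite p1.
- by clear -kK; lia.
move=> {kK C1 W1 a1 p1 pE s1 s} {}k1 s _ [kK [C [[S F h0 dn] a0 pC]]].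
apply: wp_seq.
apply: wp_conseq (write_ports_wp Db (K := 80 * D + 50) S _) _.
  by clear -kK; lia.
move=> k2 s2 _ [kK2 hE yE lE].
have CD : size C <= D := size_below (st_uniq S) (@st_lt _ _ _ _ _ _ S).
apply: wp_conseq
  (@write_cycle_wp _ _ _ _ ow' hd' T' Db 0 C k2 s2 _ _ h0 _ _ _ _ _ _ _) _;
  rewrite ?hE ?lE //.
- exact: st_uniq S.
- exact: st_T S.
- exact: st_ow S.
- exact: st_hd S.
- exact: st_cnt S.
- exact: st_zero S.
- by move: CD kK2; clear; lia.
move=> _ s3 _; rewrite yE => y3; exists (ar s NX), (ar s PT), C.
have rE v R : ring D ow' (ar s NX) v R -> ring D ow (ar s NX) v R.
  case=> UR FR MR; split=> // j; rewrite MR; case: ltnP => //= jD.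
  by have [-> _ _] := E j jD.
have CDj j : j \in C -> j < D := @st_lt _ _ _ _ _ _ S j.
split=> //.
- move=> j jD; have [R rR] := st_rings S jD; exists R.
  by have [<- _ _] := E j jD; apply: rE.
- split=> //; first exact: st_uniq S.
  rewrite -(@eq_in_cycle _ (mem C) (frel (sigma T' (ar s NX)))) //.
    move=> i j iC _ /=; rewrite /sigma.
    by have [Nj _] := rings_step (st_rings S) (CDj _ iC); have [_ _ ->] := E _ Nj.
- move=> j jC; have jD := CDj _ jC.
  have [R [rR pR xR]] := dn j jD (pC j jC); exists R; split=> //.
  by have [<- _ _] := E j jD; apply: rE.
rewrite y3; congr (_ ++ _ :: flatten _); apply/eq_in_map => j jC.
by have [-> -> _] := E j (CDj _ jC).
Qed.

End Input.

(** * From the output to the graph *)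

Lemma size_darts j rs : [::] \notin rs -> size rs <= size (darts j rs).
Proof.
elim: rs j => [|r rs IH] j //=; rewrite inE negb_or => /andP[r0 /(IH j.+1)].
by rewrite size_cat size_map; case: r r0 => //= u r _; clear; lia.
Qed.

Lemma map_index (X : eqType) (s : seq X) : uniq s ->
  [seq index x s | x <- s] = iota 0 (size s).
Proof.
move=> U; case sE: s => [//|x0 q]; rewrite -sE.
rewrite -[X in map _ X](mkseq_nth x0 s) /mkseq -map_comp -[RHS]map_id.
by apply/eq_in_map => i; rewrite mem_iota => /andP[_ it] /=; rewrite index_uniq.
Qed.

(** Ports are positions along [R] counted from 1, so the next dart has the next port, and the end of
    [R] wraps round to port 1. *)
Lemma done_next D ow N (pt : nat -> nat) v R k : ring D ow N v R ->
  (forall i, i < size R -> pt (nth 0 R i) = i.+1) -> k \in R ->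
  pt (N k) = (pt k %% size R).+1.
Proof.
case=> U F _ pR kR.
have ptE j : j \in R -> pt j = (index j R).+1.
  by move=> jR; rewrite -{1}(nth_index 0 jR) pR // index_mem.
rewrite (ptE k kR) -(nextE F kR) next_nth kR.
have := kR; rewrite -index_mem; case: (R) pR => // c q pR /=; set i := (if _ then _ else _).
rewrite ltnS leq_eqVlt => /orP[/eqP->|iq].
  by rewrite nth_default // modnn (pR 0).
by rewrite modn_small // (set_nth_default 0) //; apply: (pR i.+1).
Qed.

Section Graph.
Variables (n : nat) (e : rel 'I_n) (adj : 'I_n -> seq 'I_n).
Hypotheses (n1 : 1 < n) (Ge : simple_graph e) (Ce : connected_graph e)
  (Ae : adjacency_lists e adj).

Definition rows_of : seq (seq nat) :=
  [seq [seq val u | u <- adj v] | v <- enum 'I_n].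
Notation dd := (darts 0 rows_of).
Notation D := (size dd).
Notation ow := (fun k => (nth (0, 0) dd k).1).
Notation hd := (fun k => (nth (0, 0) dd k).2).
Notation T := (fun k => index (hd k, ow k) dd).

Lemma rows_codeE : graph_code adj = n :: rows_code rows_of.
Proof.
rewrite /graph_code /rows_code; congr (_ :: flatten _); rewrite -[RHS]map_comp.
by apply: eq_map => v /=; rewrite size_map.
Qed.

Lemma size_rows : size rows_of = n.
Proof. by rewrite size_map size_enum_ord. Qed.

Lemma mem_adj v u : (u \in adj v) = e v u.
Proof. by have [_ ->] := Ae v. Qed.

(** A connected graph with two nodes or more has no isolated node. *)
Lemma rows_nonempty : [::] \notin rows_of.
Proof.
apply/mapP => -[v _] /esym /(congr1 size) /=; rewrite size_map => /size0nil a0.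
have [w wv] : exists w : 'I_n, w != v.
  have : 1 < #|'I_n| by rewrite card_ord.
  case/card_gt1P => x [y [_ _ xy]]; have [xv|] := eqVneq x v; last by exists x.
  by exists y; rewrite -xv eq_sym.
have /connectP[[|c p] /= ep wE] := Ce v w; first by rewrite wE eqxx in wv.
by case/andP: ep; rewrite -mem_adj a0.
Qed.

Lemma rows_lt : all (all (gtn n)) rows_of.
Proof. by apply/allP => r /mapP[v _ ->]; apply/allP => k /mapP[u _ ->] /=. Qed.

Lemma rows_uniq : all uniq rows_of.
Proof.
apply/allP => r /mapP[v _ ->]; rewrite map_inj_uniq; last exact: val_inj.
by have [] := Ae v.
Qed.

Definition arcs : seq ('I_n * 'I_n) :=
  flatten [seq [seq (v, u) | u <- adj v] | v <- enum 'I_n].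

Definition code_arc (a : 'I_n * 'I_n) := (val a.1, val a.2).

Lemma code_arc_inj : injective code_arc.
Proof. by move=> [u v] [u' v'] [/val_inj-> /val_inj->]. Qed.

Lemma ddE : dd = map code_arc arcs.
Proof.
rewrite /arcs /rows_of map_flatten -map_comp.
have : [seq val v | v <- enum 'I_n] = iota 0 (size (enum 'I_n)).
  by rewrite val_enum_ord size_enum_ord.
elim: (enum 'I_n) 0 => [|v s IH] j //= [vE sE].
by rewrite (IH _ sE) -!map_comp /= -vE.
Qed.

Lemma mem_arcs v u : ((v, u) \in arcs) = e v u.
Proof.
apply/flatten_mapP/idP => [[v' _ /mapP[u' + [-> ->]]]|vu]; first by rewrite mem_adj.
by exists v; rewrite ?mem_enum //; apply: map_f; rewrite mem_adj.
Qed.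

Lemma dd_uniq : uniq dd.
Proof. exact: darts_uniq rows_uniq. Qed.

Lemma arcs_uniq : uniq arcs.
Proof. by rewrite -(map_inj_uniq code_arc_inj) -ddE dd_uniq. Qed.

Definition idx (v u : 'I_n) := index (val v, val u) dd.

Lemma idxP v u : e v u ->
  [/\ idx v u < D, ow (idx v u) = v & hd (idx v u) = u].
Proof.
move=> vu; have vd : (val v, val u) \in dd.
  by rewrite ddE; apply: (map_f code_arc (x := (v, u))); rewrite mem_arcs.
by rewrite /idx index_mem vd nth_index.
Qed.

Lemma idx_ex k : k < D -> exists v u, e v u /\ k = idx v u.
Proof.
move=> kD; have := mem_nth (0, 0) kD; rewrite {2}ddE => /mapP[[v u]].
rewrite mem_arcs => vu kE; exists v, u; split=> //.
by rewrite /idx -[(_, _)]kE index_uniq // dd_uniq.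
Qed.

Lemma twin_idx v u : e v u -> T (idx v u) = idx u v.
Proof. by move=> /idxP[_ -> ->]. Qed.

Lemma dd_sym k : k < D -> (hd k, ow k) \in dd.
Proof.
move=> /idx_ex[v [u [vu ->]]]; have [_ -> ->] := idxP vu.
by rewrite -index_mem; have [] := idxP (v := u) (u := v); rewrite // Ge.1.
Qed.

Lemma dd_gt0 : 0 < D.
Proof.
apply: leq_trans (size_darts 0 rows_nonempty); rewrite size_rows.
exact: ltnW.
Qed.

Lemma dd_le : D <= 2 * #|edges e|.
Proof.
rewrite ddE size_map.
(* An arc is recovered from its edge and from whether its tail is the smaller end, so there are at
   most two arcs per edge. *)
pose f (a : 'I_n * 'I_n) := ([set a.1; a.2], a.1 < a.2).
have fI : {in arcs &, injective f}.
  move=> [v u] [v' u']; rewrite !mem_arcs => vu vu' [E lt].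
  have [vv'|vv'] := eqVneq v v'.
    by move: E; rewrite -vv' => /(set2_inj Ge vu)->.
  have := set21 v u; rewrite E !inE (negPf vv') /= => /eqP vu'E.
  have := set21 v' u'; rewrite -E !inE eq_sym (negPf vv') /= => /eqP v'uE.
  have uv : u != v by apply: contraTneq vu => ->; rewrite Ge.2.
  move: lt uv; rewrite -vu'E v'uE -val_eqE /=; clear.
  by case: ltngtP.
rewrite -(size_map f).
apply: (@leq_trans (size (allpairs pair (enum (edges e)) [:: true; false]))).
  apply: uniq_leq_size; first by rewrite map_inj_in_uniq // arcs_uniq.
  move=> _ /mapP[[v u] + ->]; rewrite mem_arcs => vu.
  apply/allpairsP; exists (f (v, u)); split; rewrite ?mem_enum //.
    by apply/imsetP; exists (v, u); rewrite ?inE.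
  by case: (f _).2.
by rewrite size_allpairs -cardE mulnC.
Qed.

(** * The port numbering and the witness cycle of a solution *)

Section Solution.
Variables (N pt : nat -> nat) (C : seq nat) (y : seq nat).
Hypothesis (sol : solution rows_of N pt C y).

Let TP := twinP rows_uniq dd_sym.

Lemma sol_rings : rings D ow N. Proof. by have [] := sol. Qed.

Lemma sol_cyc : cyc D T N C. Proof. by have [] := sol. Qed.

(** The owner of dart 0 is on the cycle, and [visited_step] carries this along paths of the
    connected graph. *)
Lemma sol_visited (v : 'I_n) : exists2 k, k \in C & ow k = v.
Proof.
have [rN cC h0 dn _] := sol; have [_ _ CD] := cC.
have C0 : 0 \in C by case: (C) h0 => //= c q ->; apply: mem_head.
have [v0 [u0 [vu0 e0]]] := idx_ex dd_gt0; have [_ o0 _] := idxP vu0.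
have /connectP[p] := Ce v0 v; have : exists2 k, k \in C & ow k = v0.
  by exists 0 => //; rewrite -o0 -e0.
elim: p v0 {vu0 o0 e0} => [|c p IH] w [k kC kw] /=; first by move=> _ ->; exists k.
case/andP=> wc cp; apply: IH cp.
have [iD oi hi] := idxP wc; rewrite -hi.
have oik : ow (idx w c) = ow k by rewrite oi kw.
exact: (visited_step TP cC rN kC (dn k kC) iD oik).
Qed.

Lemma sol_done (v : 'I_n) : done D ow N C pt v.
Proof.
have [k kC <-] := sol_visited v; have [_ _ _ dn _] := sol; exact: dn.
Qed.

(** Ports are attached to edges as sets, so the far end is picked back from the set; the value 0 is
    a default off the incident edges. *)
Definition port (v : 'I_n) (E : {set 'I_n}) : nat :=
  if [pick u | (E == [set v; u]) && e v u] is Some u then pt (idx v u) else 0.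

Lemma portE v u : e v u -> port v [set v; u] = pt (idx v u).
Proof.
move=> vu; rewrite /port; case: pickP => [w /andP[/eqP E vw]|/(_ u)].
  by rewrite (set2_inj Ge vu E).
by rewrite eqxx vu.
Qed.

Lemma incident_seq v : incident e v =i [seq [set v; u] | u <- adj v].
Proof.
move=> E; apply/idP/mapP => [/(incident_arc Ge)[w vw ->]|[w + ->]].
  by exists w; rewrite ?mem_adj.
by rewrite mem_adj => vw; have [] := arc_incident vw.
Qed.

Lemma degreeE v : degree e v = size (adj v).
Proof.
rewrite /degree (eq_card (incident_seq v)) -[RHS](size_map (fun u => [set v; u])).
apply/card_uniqP; rewrite map_inj_in_uniq; first by have [] := Ae v.
by move=> u w; rewrite !mem_adj => vu _; apply: (set2_inj Ge vu).
Qed.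

Lemma mem_ring v R : ring D ow N (val v) R -> forall k,
  reflect (exists2 u, e v u & k = idx v u) (k \in R).
Proof.
case=> _ _ M k; rewrite M; apply: (iffP andP) => [[kD /eqP kv]|[u vu ->]].
  have [w [u [wu kE]]] := idx_ex kD; have [_ ow_ _] := idxP wu.
  by exists u; move: kv; rewrite kE ow_ => /val_inj <-.
by have [-> -> _] := idxP vu.
Qed.

Lemma size_ring v R : ring D ow N (val v) R -> size R = degree e v.
Proof.
move=> rR; rewrite degreeE -(size_map (idx v)).
apply/perm_size/uniq_perm; first by case: rR.
  rewrite map_inj_in_uniq; first by have [] := Ae v.
  move=> u w; rewrite !mem_adj => /idxP[_ _ hu] /idxP[_ _ hw] E.
  by apply: val_inj; rewrite /= -hu -hw E.
move=> k; apply/(mem_ring rR)/mapP => -[u vu ->]; exists u => //.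
  by rewrite mem_adj.
by rewrite -mem_adj.
Qed.

(** The darts of [v] are in bijection with its edges, and their ports are the positions from 1 in
    the duplicate-free ring [R], whose length is the degree. *)
Lemma port_numbering_port : port_numbering e port.
Proof.
move=> v; have [R [rR pR _]] := sol_done v.
have ptE u : e v u -> port v [set v; u] = (index (idx v u) R).+1 /\ idx v u \in R.
  move=> vu; have uR : idx v u \in R by apply/(mem_ring rR); exists u.
  by rewrite portE // -pR ?index_mem // nth_index.
split=> [E E'|i].
  move=> /(incident_arc Ge)[u vu ->] /(incident_arc Ge)[w vw ->].
  have [-> uR] := ptE _ vu; have [-> wR] := ptE _ vw => -[/index_inj].
  move=> /(_ 0 uR) uw; have [_ _ hu] := idxP vu; have [_ _ hw] := idxP vw.
  by congr [set _; _]; apply: val_inj; rewrite /= -hu -hw uw.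
rewrite -(size_ring rR); split=> [|[E /(incident_arc Ge)[u vu ->] <-]].
  case: i => // i iR; have := mem_nth 0 iR => /(mem_ring rR)[u vu iE].
  exists [set v; u]; first by have [] := arc_incident vu.
  by rewrite portE // -iE pR.
by have [-> uR] := ptE _ vu; rewrite /= index_mem.
Qed.

(** The pair is reversed because the dart from [v] to [u] stands for the arc from [u] to [v]. *)
Definition in_arc k : 'I_n * 'I_n :=
  let a := nth (Ordinal n1, Ordinal n1) arcs k in (a.2, a.1).

Lemma in_arc_idx v u : e v u -> in_arc (idx v u) = (u, v).
Proof.
move=> vu; have iE : idx v u = index (v, u) arcs.
  by rewrite /idx ddE -(index_map code_arc_inj).
by rewrite /in_arc iE nth_index ?mem_arcs.
Qed.

Lemma witness_in_arc : witness_cycle e port [seq in_arc k | k <- C].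
Proof.
have [UC FC CD] := sol_cyc; have [_ _ h0 _ _] := sol.
split; last first.
  move=> v; have [k kC kv] := sol_visited v; exists (in_arc k); first exact: map_f.
  have [w [u [wu kE]]] := idx_ex (CD _ kC); have [_ ow_ _] := idxP wu.
  right; rewrite kE in_arc_idx //=; apply: val_inj.
  by rewrite -[LHS]kv kE -[RHS]ow_.
split; first by case: (C) h0.
apply/andP; split; last first.
  rewrite map_inj_in_uniq // => j k /CD/idx_ex[v [u [vu ->]]].
  by move=> /CD/idx_ex[v' [u' [vu' ->]]]; rewrite !in_arc_idx // => -[-> ->].
rewrite cycle_map; apply: (sub_in_cycle _ _ FC (P := mem C)) => [j k jC _ /= /eqP <-|].
  have jD := CD _ jC; have [v [u [vu jE]]] := idx_ex jD.
  have [_ oj hj] := idxP vu; rewrite -jE in oj hj.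
  have [ND oN] := rings_step sol_rings jD.
  have [v' [w [vw NE]]] := idx_ex ND.
  have vv : v' = v.
    have [_ ov _] := idxP vw; rewrite -NE in ov.
    by apply: val_inj; apply: etrans (etrans (esym ov) (etrans oN oj)) _.
  rewrite {}vv in vw NE.
  have wv : e w v by rewrite Ge.1.
  have uv : e u v by rewrite Ge.1.
  (* The dart [(v, u)] stands for the arc [(u, v)], and its image [(w, v)] for the arc [(v, w)]; [N]
     leads from one port at [v] to the next. *)
  have sE : sigma T N j = idx w v by rewrite /sigma NE; apply: twin_idx.
  rewrite sE (in_arc_idx wv) jE (in_arc_idx vu).
  rewrite /rh_succ /Defs.arc /= uv vw eqxx /= (portE vw) setUC (portE vu).
  have [R [rR pR _]] := sol_done v.
  rewrite -(size_ring rR) -NE jE; apply/eqP.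
  rewrite -jE; apply: (done_next rR pR).
  by rewrite jE; apply/(mem_ring rR); exists u.
exact/allP.
Qed.

Lemma solution_codeE : y = solution_code adj port [seq in_arc k | k <- C].
Proof.
have [_ [_ _ CD] _ _ ->] := sol; rewrite /solution_code size_map.
congr (_ ++ _ :: flatten _); last first.
  rewrite -map_comp; apply/eq_in_map => k /CD/idx_ex[v [u [vu kE]]].
  rewrite -[RHS]/[:: val (in_arc k).1; val (in_arc k).2] kE (in_arc_idx vu).
  by have [_ -> ->] := idxP vu.
rewrite -(map_index dd_uniq) -map_comp {2}ddE -map_comp /arcs map_flatten.
congr flatten; rewrite -map_comp; apply/eq_in_map => v _ /=.
rewrite -map_comp; apply/eq_in_map => u; rewrite mem_adj => vu /=.
by rewrite portE.
Qed.

End Solution.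
End Graph.

(** * Time and register bounds in the number of edges *)

Theorem theorem2 :
  exists (P : program) (c : nat),
  forall (n : nat) (e : rel 'I_n) (adj : 'I_n -> seq 'I_n),
    1 < n -> simple_graph e -> connected_graph e -> adjacency_lists e adj ->
    exists (p : 'I_n -> {set 'I_n} -> nat) (W : seq ('I_n * 'I_n)),
      [/\ port_numbering e p,
          witness_cycle e p W &
          ram_computes P (graph_code adj) (solution_code adj p W)
            (c * #|edges e|) (#|edges e|.+1 ^ c)].
Proof.
(* With [m] edges, [n <= D <= 2 * m] and [0 < m] bound the time [8 * (200 * D + 10 * n + 100)] by
   [4160 * m]. The existential keeps the constant folded. *)
have [c cE] : exists c, c = 42 * 100 by exists (42 * 100).
have c9 : 9 <= c by rewrite cE.
exists (compile 0 witness_cmd), c => n e adj n1 Ge Ce Ae.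
have Ddef := erefl (size (darts 0 (rows_of adj))); set D := {1}(size _) in Ddef.
have D2 : D <= 2 * #|edges e| by rewrite Ddef; apply: dd_le.
have nD : n <= D.
  by rewrite Ddef -{1}(size_rows adj); apply/size_darts/rows_nonempty.
set m := #|edges e| in D2 *.
have m0 : 0 < m by clear -n1 nD D2; lia.
(* The term [n * n + n] covers the matrix indices and [D.+1] the dart numbers. *)
pose b := n * n + n + D.+1.
have xb : all (fun z => z <= b) (graph_code adj).
  apply/allP => z; rewrite inE => /orP[/eqP->|]; first by rewrite /b; clear; lia.
  suff zn : z \in flatten [seq size (adj v) :: [seq val u | u <- adj v]
                          | v <- enum 'I_n] -> z <= n.
    by move=> /zn; rewrite /b; clear; lia.
  case/flatten_mapP => v _; rewrite inE => /orP[/eqP->|/mapP[u _ ->]].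
    have [U _] := Ae v; rewrite -[leqRHS]card_ord -(card_uniqP U).
    exact: max_card.
  exact: ltnW (ltn_ord u).
have [] := @wp_ram witness_cmd b (200 * D + 10 * n + 100) _
  (fun s => exists N pt C, solution (rows_of adj) N pt C (out s)) xb.
  apply: witness_cmd_wp (rows_codeE adj) _ => //.
  - exact: size_rows.
  - exact: (rows_nonempty n1 Ce Ae).
  - exact: rows_lt.
  - exact: (rows_uniq Ae).
  - by rewrite -Ddef /b; clear; lia.
  - by rewrite /b; clear; lia.
  - exact: (dd_gt0 n1 Ce Ae).
  - exact: (dd_sym Ge Ae).
move=> s [N [pt [C sol]]] [t [tk tP tO tb]].
exists (port e adj pt), [seq in_arc adj n1 k | k <- C]; split.
- exact: (port_numbering_port n1 Ge Ce Ae sol).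
- exact: (witness_in_arc n1 Ge Ce Ae sol).
rewrite -(solution_codeE n1 Ge Ae sol); exists t; split=> //.
  by apply: leq_trans tk _; clear -cE D2 nD m0; rewrite cE; nia.
move=> j i jt; apply: leq_trans (tb j i jt) _.
(* The register bound [16 * b + 16] is at most 128 times the square of [m.+1], and [128 = 2 ^ 7] is
   at most [m.+1 ^ 7]. *)
apply: (@leq_trans (m.+1 ^ 9)); last exact: leq_pexp2l c9.
have nn : n * n <= 2 * m * (2 * m) by apply: leq_mul; apply: leq_trans nD D2.
have -> : m.+1 ^ 9 = m.+1 * m.+1 * m.+1 ^ 7 by rewrite -mulnA -!expnS.
have : 2 ^ 7 <= m.+1 ^ 7 by rewrite leq_exp2r.
rewrite -(leq_pmul2l (m := m.+1 * m.+1)) //; apply: leq_trans.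
by rewrite /b; clear -nn nD D2 m0; nia.
Qed.
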